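(* There is an absolute constant $K$ such that the following holds. Let $0\le r_\diamond<m_\diamond$ be integers and let $(r,m)=(r_\diamond-i,m_\diamond-i)$ for some integer $0\le i\le\min(r_\diamond,m_\diamond-r_\diamond-1)$. Then there is a unitary encoder $U^{( *,0)}(r,m;r_\diamond,m_\diamond)$ of $\mathrm{pQRM}^{(0)}(r,m;r_\diamond,m_\diamond)$ on $2^m-1$ qubits, realized by a circuit of Hadamard gates, CNOT gates and qubit permutations of depth at most $Km$ (that is, logarithmic in the number of qubits), whose number of CNOT gates is $\zeta^{( *,0)}(r,m;r_\diamond,m_\diamond)$, where $$\zeta^{( *,0)}(r,m;r_\diamond,m_\diamond)=\begin{cases}\zeta^{( *,c)}(r_\diamond,m)&\text{if } 2r_\diamond+1\le m_\diamond,\ r=0,\\ \zeta^{*}(r_\diamond)&\text{if }2r_\diamond+1>m_\diamond,\ r=2r_\diamond-m_\diamond+1,\\ \sum_{j=r}^{r_\diamond}\binom{m-1}{j}+\zeta^{( *,0)}(r-1,m-1;r_\diamond,m_\diamond)+\zeta^{(0)}(r-1,m-1;r_\diamond,m_\diamond)&\text{otherwise.}\end{cases}$$ Here: $\zeta^c(s,s)=s2^{s-1}$ and $\zeta^c(s,t)=\sum_{j=0}^{s}\binom{t-1}{j}+2\zeta^c(s,t-1)$ for $0\le s<t$; $\zeta^*(0)=0$ and $\zeta^*(s)=2^s+\zeta^*(s-1)+\zeta^c(s-1,s)$ for $s\ge1$; $\zeta^{( *,c)}(s,s+1)=\zeta^*(s)$ and $\zeta^{( *,c)}(s,t)=\sum_{j=0}^{s}\binom{t-1}{j}+\zeta^{(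 *,c)}(s,t-1)+\zeta^c(s,t-1)$ for $0\le s<t-1$; and $\zeta^{(0)}(r,m;r_\diamond,m_\diamond)$ equals $\zeta^c(r_\diamond,m)$ if $2r_\diamond+1\le m_\diamond$ and $r=-1$, equals $\zeta^c(r_\diamond,r_\diamond)$ if $2r_\diamond+1>m_\diamond$ and $m=r_\diamond$, and equals $\sum_{j=r}^{r_\diamond}\binom{m-1}{j}+2\zeta^{(0)}(r-1,m-1;r_\diamond,m_\diamond)$ otherwise.
   Context: For $0\le r\le m$, $\mathrm{RM}(r,m)\subseteq\mathbb F_2^{2^m}$ is the binary Reed-Muller code: the set of evaluation vectors $\mathrm{Eval}^{(m)}(f)=(f(\boldsymbol\rho(1)),\dots,f(\boldsymbol\rho(2^m)))$ of polynomials $f\in\mathbb F_2[x_1,\dots,x_m]$ of degree at most $r$, where $\boldsymbol\rho(j)$ is the $m$-bit binary representation of $j-1$. For a vector $\mathbf c$, $\mathbf c^*$ denotes $\mathbf c$ with its first coordinate deleted, and $\mathrm{pRM}(r,m)=\{\mathbf c^*:\mathbf c\in\mathrm{RM}(r,m)\}$. $\mathrm{pRM}(r,m)/\{\mathbf 1\}$ denotes the span of the punctured evaluation vectors of monomials of degree between $1$ and $r$ ($\{\mathbf 0\}$ if $r=0$). $\mathrm{pQRM}^{(0)}(r,m;r_\diamond,m_\diamond)$ has basis codewords $|\mathbf w\rangle^{( *,0)}_{r,m}=|\mathrm{pRM}(r,m)/\{\mathbf 1\}|^{-1/2}\sum_{\mathbf c\in\mathrm{pRM}(r,m)/\{\mathbf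 1\}}|\mathbf w\oplus\mathbf c\rangle$, $\mathbf w\in\mathrm{pRM}(r_\diamond,m)$, on $2^m-1$ qubits. With $k=1+\sum_{j=r+1}^{r_\diamond}\binom mj$, a unitary $U$ on $2^m-1$ qubits is an encoder of $\mathrm{pQRM}^{(0)}(r,m;r_\diamond,m_\diamond)$ if for every $\mathbf m\in\mathbb F_2^k$, $U|\mathbf m\rangle|0\rangle^{\otimes(2^m-1-k)}=|\mathbf mG_1\rangle^{( *,0)}_{r,m}$, where the rows of $G_1$ (in some fixed order) are the all-ones vector and the punctured evaluation vectors of the monomials in $x_1,\dots,x_m$ of degree between $r+1$ and $r_\diamond$. Qubit permutations are relabelings of qubits and are not counted in the gate count or the depth; depth is the number of layers of gates acting on disjoint qubits. *)

(* Defs.v *)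
From HB Require Import structures.
From mathcomp Require Import all_boot all_order all_fingroup all_algebra.
From mathcomp Require Import spectral complex mpoly reals.

Set Implicit Arguments.
Unset Strict Implicit.
Unset Printing Implicit Defensive.

Import Order.TTheory GRing.Theory Num.Theory.
Local Open Scope ring_scope.

(* Bits, and hence the variables x_1, ..., x_m, are numbered from the most
   significant one; coordinates are numbered from 0, so that coordinate j is
   evaluation at the binary representation of j. *)
Definition bits (m : nat) (j : 'I_(2 ^ m)) (k : 'I_m) : 'F_2 :=
  (j %/ 2 ^ (m - k.+1))%:R.

Definition Eval (m : nat) (f : {mpoly 'F_2[m]}) : 'rV['F_2]_(2 ^ m) :=
  \row_j f.@[bits j].

Lemma pow2_gt0 (m : nat) : (0 < 2 ^ m)%N.
Proof. by rewrite expn_gt0. Qed.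

Definition puncture (m : nat) (c : 'rV['F_2]_(2 ^ m)) : 'rV['F_2]_(2 ^ m).-1 :=
  col' (Ordinal (pow2_gt0 m)) c.

(* msize f is 1 + deg f, and 0 for f = 0. *)
Definition in_RM (r m : nat) (c : 'rV['F_2]_(2 ^ m)) : Prop :=
  exists2 f : {mpoly 'F_2[m]}, (msize f <= r.+1)%N & c = Eval f.

Definition in_pRM (r m : nat) (c : 'rV['F_2]_(2 ^ m).-1) : Prop :=
  exists2 c' : 'rV['F_2]_(2 ^ m), in_RM r c' & c = puncture c'.

(* Since x ^ 2 = x on F_2, "monomial" means squarefree monomial, that is the
   product of the x_i for i in a set A; its degree is #|A|. *)
Definition pmonomials (m a b : nat) : seq 'rV['F_2]_(2 ^ m).-1 :=
  [seq puncture (Eval 'X_[mesym1 A])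
     | A <- enum [set A : {set 'I_m} | (a <= mdeg (mesym1 A) <= b)%N]].

Definition pRM_mod1 (r m : nat) : {vspace 'rV['F_2]_(2 ^ m).-1} :=
  <<pmonomials m 1 r>>%VS.

(* Operators and states of n qubits are matrices and column vectors indexed by
   the computational basis 'rV['F_2]_n, through its enumeration. *)
Definition qdim (n : nat) : nat := #|{: 'rV['F_2]_n}|.

Definition ket (C : numClosedFieldType) (n : nat) (x : 'rV['F_2]_n) :
    'cV[C]_(qdim n) :=
  delta_mx (enum_rank x) 0.

(* The operator with matrix coefficients <y|U|x> = f y x. *)
Definition opmx (C : numClosedFieldType) (n : nat)
    (f : 'rV['F_2]_n -> 'rV['F_2]_n -> C) : 'M[C]_(qdim n) :=
  \matrix_(i, j) f (enum_val i) (enum_val j).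

(* CNOT c t has control c and target t. *)
Inductive gate (n : nat) : Type :=
  | Hadamard of 'I_n
  | CNOT of 'I_n & 'I_n.

Definition gate_qubits (n : nat) (g : gate n) : seq 'I_n :=
  match g with
  | Hadamard q => [:: q]
  | CNOT c t => [:: c; t]
  end.

Definition is_CNOT (n : nat) (g : gate n) : bool :=
  if g is CNOT _ _ then true else false.

Definition gate_mx (C : numClosedFieldType) (n : nat) (g : gate n) :
    'M[C]_(qdim n) :=
  match g with
  | Hadamard q => opmx (fun y x =>
      if [forall i, (i != q) ==> (y 0 i == x 0 i)]
      then (-1) ^+ ((x 0 q != 0) && (y 0 q != 0)) / sqrtC 2 else 0)
  | CNOT c t => opmx (fun y x => (y == x + x 0 c *: delta_mx 0 t)%:R)
  end.

Inductive step (n : nat) : Type :=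
  | Layer of seq (gate n)
  | Relabel of {perm 'I_n}.

Definition circuit (n : nat) : Type := seq (step n).

(* In particular, CNOT q q is not allowed. *)
Definition step_wf (n : nat) (s : step n) : bool :=
  if s is Layer gs then uniq (flatten (map (@gate_qubits n) gs)) else true.

Definition circuit_wf (n : nat) (c : circuit n) : bool := all (@step_wf n) c.

Definition step_mx (C : numClosedFieldType) (n : nat) (s : step n) :
    'M[C]_(qdim n) :=
  match s with
  | Layer gs => foldr (fun g U => U *m gate_mx C g) 1%:M gs
  | Relabel p => opmx (fun y x => (y == col_perm p x)%:R)
  end.

(* The head of the list acts first. *)
Definition circuit_mx (C : numClosedFieldType) (n : nat) (c : circuit n) :
    'M[C]_(qdim n) :=
  foldr (fun s U => U *m step_mx C s) 1%:M c.

Definition depth (n : nat) (c : circuit n) : nat :=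
  count (fun s => if s is Layer _ then true else false) c.

Definition CNOT_count (n : nat) (c : circuit n) : nat :=
  sumn [seq (if s is Layer gs then count (@is_CNOT n) gs else 0%N) | s <- c].

(* The basis codeword |w>^{*,0}_{r,m}; it does not depend on md, and depends
   on rd only through the range pRM(rd, m) of w. *)
Definition codeword (C : numClosedFieldType) (r m : nat)
    (w : 'rV['F_2]_(2 ^ m).-1) : 'cV[C]_(qdim (2 ^ m).-1) :=
  (sqrtC #|[pred c in pRM_mod1 r m]|%:R)^-1 *:
    \sum_(c : 'rV['F_2]_(2 ^ m).-1 | c \in pRM_mod1 r m) ket C (w + c).

Definition num_logical (r m rd : nat) : nat :=
  (1 + \sum_(r.+1 <= j < rd.+1) 'C(m, j))%N.

Definition is_G1 (r m rd : nat)
    (G : 'M['F_2]_(num_logical r m rd, (2 ^ m).-1)) : Prop :=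
  perm_eq [seq row i G | i <- enum 'I_(num_logical r m rd)]
          (const_mx 1 :: pmonomials m r.+1 rd).

(* v followed by zeros, in length n. *)
Definition pad (k n : nat) (v : 'rV['F_2]_k) : 'rV['F_2]_n :=
  \row_(q < n) (if insub (q : nat) is Some i then v 0 i else 0).

Definition is_encoder (C : numClosedFieldType) (r m rd : nat)
    (U : 'M[C]_(qdim (2 ^ m).-1)) : Prop :=
  exists2 G, @is_G1 r m rd G &
    forall msg : 'rV['F_2]_(num_logical r m rd),
      U *m ket C (pad (2 ^ m).-1 msg) = codeword C r (msg *m G).

(* The encoded words do range in pRM(rd, m). *)
Lemma is_G1_pRM (r m rd : nat) G (msg : 'rV['F_2]_(num_logical r m rd)) :
  is_G1 G -> in_pRM rd (msg *m G).
Proof.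
move=> HG; rewrite mulmx_sum_row.
have H0 : in_pRM rd (0 : 'rV['F_2]_(2 ^ m).-1).
  exists 0; last by apply/rowP=> j; rewrite !mxE.
  by exists 0; rewrite ?msize0 //; apply/rowP=> j; rewrite !mxE mpoly.meval0.
elim/big_ind: _ => // [x y|i _].
  case=> _ [f sf ->] ->; case=> _ [g sg ->] ->.
  exists (Eval (f + g)); last by apply/rowP=> j; rewrite !mxE mevalD.
  exists (f + g) => //; apply: leq_trans (msizeD_le _ _) _.
  by rewrite geq_max sf sg.
have {HG} : row i G \in const_mx 1 :: pmonomials m r.+1 rd.
  by rewrite -(perm_mem HG); apply: (map_f (fun i => row i G)); rewrite mem_enum.
have HE (f : {mpoly 'F_2[m]}) (a : 'F_2) : (msize f <= rd.+1)%N ->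
    in_pRM rd (a *: puncture (Eval f)).
  move=> sf; exists (Eval (a *: f)); last by apply/rowP=> j; rewrite !mxE mevalZ.
  by exists (a *: f) => //; apply: leq_trans (msizeZ_le _ _) sf.
rewrite inE => /orP[/eqP->|].
  have -> : const_mx 1 = puncture (@Eval m 1).
    by apply/rowP=> j; rewrite !mxE meval1.
  by apply: HE; rewrite msize1.
case/mapP=> A; rewrite mem_enum inE => /andP[_ hA] ->.
by apply: HE; rewrite msizeX.
Qed.

(* Each recursion below carries a junk value 0 outside its domain. *)

(* zeta^c(s, t), for s <= t *)
Fixpoint zeta_c (s t : nat) : nat :=
  if t == s then (s * 2 ^ s.-1)%N else
  if t is t'.+1 then (\sum_(0 <= j < s.+1) 'C(t', j) + 2 * zeta_c s t')%N
  else 0%N.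

Fixpoint zeta_star (s : nat) : nat :=
  if s is s'.+1 then (2 ^ s + zeta_star s' + zeta_c s' s)%N else 0%N.

(* zeta^{*,c}(s, t), for s < t *)
Fixpoint zeta_star_c (s t : nat) : nat :=
  if t == s.+1 then zeta_star s else
  if t is t'.+1 then
    (\sum_(0 <= j < s.+1) 'C(t', j) + zeta_star_c s t' + zeta_c s t')%N
  else 0%N.

(* zeta^(0)(r, m; rd, md); r is an integer because the recursion stops at
   r = -1. *)
Fixpoint zeta_0 (rd md : nat) (r : int) (m : nat) : nat :=
  if (2 * rd + 1 <= md)%N && (r == -1) then zeta_c rd m else
  if (md < 2 * rd + 1)%N && (m == rd) then zeta_c rd rd else
  if m is m'.+1 then
    (\sum_(0 <= j < rd.+1 | (r <= j%:Z)%R) 'C(m', j)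
       + 2 * zeta_0 rd md (r - 1)%R m')%N
  else 0%N.

(* zeta^{*,0}(r, m; rd, md) *)
Fixpoint zeta_star_0 (rd md : nat) (r : int) (m : nat) : nat :=
  if (2 * rd + 1 <= md)%N && (r == 0) then zeta_star_c rd m else
  if (md < 2 * rd + 1)%N && (r == 2 * rd%:Z - md%:Z + 1) then zeta_star rd else
  if m is m'.+1 then
    (\sum_(0 <= j < rd.+1 | (r <= j%:Z)%R) 'C(m', j)
       + zeta_star_0 rd md (r - 1)%R m' + zeta_0 rd md (r - 1)%R m')%N
  else 0%N.

(* Main.v *)
Require Import Defs.
From HB Require Import structures.
From mathcomp Require Import all_boot all_order all_fingroup all_algebra.
From mathcomp Require Import spectral complex mpoly reals zify.

Set Implicit Arguments.
Unset Strict Implicit.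
Unset Printing Implicit Defensive.

Import Order.TTheory GRing.Theory Num.Theory.
Local Open Scope ring_scope.

(* Each qubit is labelled by a set of variables, and its input is the coefficient
   of the corresponding monomial; this is zero in degree above [rd], and a
   Hadamard gate puts it into a uniform superposition in degree between 1 and
   [r]. Processing the variables one by one, with a CNOT gate from [P] minus the
   current variable to each [P] containing it, is the Plotkin decomposition
   (g, g + h): it evaluates the polynomial at all points in depth [m]. A gate with
   zero control, or whose target is in uniform superposition, can be left out;
   the recursion for zeta does so while more than [rd] variables remain. The
   punctured point is the only delicate one: the constant coefficient still has
   to be held by some qubit, and it takes the place of a monomial of degree
   [rd + 1]. *)

(** The exact gate count shapes the proof. Leaving gates out changes the computed map, so the
    classical circuit is only shown correct up to a perturbation [u] of its input inside the
    superposed space. This [u] may depend on the input; but the circuit is injective and sends the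
    superposed inputs into a coset with no more elements than there are inputs, so it maps onto that
    coset and the uniform superposition does not see [u]. In the block of the last [rd + 1]
    variables, one slot is vacant: at first the full set, whose coefficient is zero, at the end the
    empty set. The sums of a set and the set without its first variable are the edges of a tree on
    the [2 ^ rd.+1 - 1] occupied slots. Storing each sum at the far end of its edge, seen from a
    chosen root, costs one gate per edge, hence [2 ^ rd.+1 - 2] gates, and moving the root moves the
    vacant slot without any swap. *)

Lemma F2_cases (a : 'F_2) : a = 0 \/ a = 1.
Proof. by case: a => [[|[|//]]] lt_a; [left | right]; apply: val_inj. Qed.

Lemma F2_addrr (a : 'F_2) : a + a = 0.
Proof. by case: (F2_cases a) => ->; apply: val_inj. Qed.

Lemma F2_rV_addrr n (x : 'rV['F_2]_n) : x + x = 0.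
Proof. by apply/rowP=> i; rewrite !mxE F2_addrr. Qed.

(** * The action of circuits on the computational basis *)

Section KetAction.
Local Open Scope sesquilinear_scope.
Variable C : numClosedFieldType.

Lemma mulmx_ket n (A : 'M[C]_(qdim n)) x : A *m ket C x = col (enum_rank x) A.
Proof. by rewrite colE. Qed.

Lemma mulmx_ketP n (A B : 'M[C]_(qdim n)) :
  (forall x, A *m ket C x = B *m ket C x) -> A = B.
Proof.
move=> eqAB; apply/matrixP=> i j.
by move/colP/(_ i): (eqAB (enum_val j)); rewrite !mulmx_ket enum_valK !mxE.
Qed.

Lemma opmx_ket n f (x : 'rV['F_2]_n) :
  opmx f *m ket C x = \sum_y f y x *: ket C y.
Proof.
apply/colP=> i; rewrite mulmx_ket mxE mxE enum_rankK summxE.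
rewrite (bigD1 (enum_val i)) //= !mxE enum_valK eqxx mulr1 big1 ?addr0 //.
move=> y neq_y; rewrite !mxE andbT; case: eqP => [eq_i|_]; last exact: mulr0.
by rewrite eq_i enum_rankK eqxx in neq_y.
Qed.

Lemma opmx_fun_ket n (phi : 'rV['F_2]_n -> 'rV['F_2]_n) x :
  opmx (fun y x => (y == phi x)%:R) *m ket C x = ket C (phi x).
Proof.
rewrite opmx_ket (bigD1 (phi x)) //= eqxx scale1r big1 ?addr0 // => y /negPf->.
exact: scale0r.
Qed.

Lemma opmx_fun_unitary n (phi : 'rV['F_2]_n -> 'rV['F_2]_n) :
  injective phi -> opmx (fun y x => (y == phi x)%:R : C) \is unitarymx.
Proof.
move=> phi_inj; apply/unitarymxP; apply: mulmx1C; apply: mulmx_ketP => x.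
rewrite -mulmxA opmx_fun_ket mul1mx.
have -> : (opmx (fun y x => (y == phi x)%:R))^t* =
          opmx (fun y x => (x == phi y)%:R : C).
  by apply/matrixP=> i j; rewrite !mxE conjC_nat.
rewrite opmx_ket (bigD1 x) //= eqxx scale1r big1 ?addr0 // => y neq_yx.
by rewrite (inj_eq phi_inj) eq_sym (negPf neq_yx) scale0r.
Qed.

Definition flip n (q : 'I_n) (b : 'F_2) : 'rV['F_2]_n := b *: delta_mx 0 q.

Lemma flipE n (q i : 'I_n) b : flip q b 0 i = if i == q then b else 0.
Proof. by rewrite !mxE eqxx; case: eqP; rewrite ?mulr1 ?mulr0. Qed.

Lemma Hadamard_ket n (q : 'I_n) x :
  gate_mx C (Hadamard q) *m ket C x =
  (sqrtC 2)^-1 *: \sum_(b : 'F_2)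
     (-1) ^+ ((x 0 q != 0) && (x 0 q + b != 0)) *: ket C (x + flip q b).
Proof.
rewrite opmx_ket scaler_sumr.
rewrite (bigID (fun y : 'rV_n => [forall i, (i != q) ==> (y 0 i == x 0 i)])) /=.
rewrite [X in _ + X]big1 ?addr0 => [|y /negPf->]; last exact: scale0r.
rewrite (reindex_onto (fun b => x + flip q b) (fun y => y 0 q - x 0 q)) /=.
  apply: eq_big => [b|b].
    rewrite mxE flipE eqxx [x 0 q + b]addrC addrK eqxx andbT; apply/forallP=> i.
    by apply/implyP=> neq_iq; rewrite mxE flipE (negPf neq_iq) addr0.
  move=> /andP[-> _]; rewrite scalerA mulrC [X in (_ && (X != 0))]mxE.
  by rewrite flipE eqxx.
move=> y /forallP eq_y; apply/rowP=> i; rewrite mxE flipE.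
case: eqP => [->|/eqP neq_iq]; first by rewrite addrC subrK.
by move/implyP/(_ neq_iq)/eqP: (eq_y i) => ->; rewrite addr0.
Qed.

(** Meant for two basis states [u], [v] that differ in one qubit, with [a] the inverse square root
    of 2. *)
Lemma involution_on_pair n (H : 'M[C]_n) (u v : 'cV_n) a : a * a *+ 2 = 1 ->
    H *m u = a *: (u + v) -> H *m v = a *: (u - v) ->
  H *m (H *m u) = u /\ H *m (H *m v) = v.
Proof.
move=> a2 Hu Hv; rewrite Hu Hv -!scalemxAr mulmxDr mulmxBr Hu Hv.
rewrite -scalerDr -scalerBr !scalerA opprB [v - u]addrC.
rewrite [_ + (u - v)]addrACA [_ + (- u + v)]addrACA !subrr addr0 add0r -!mulr2n.
by rewrite -!scalerMnr !scalerMnl a2 !scale1r.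
Qed.

Lemma Hadamard_unitary n (q : 'I_n) : gate_mx C (Hadamard q) \is unitarymx.
Proof.
apply/unitarymxP.
set H := gate_mx C _.
have -> : H^t* = H.
  apply/matrixP=> i j; rewrite !mxE.
  have -> : [forall k, (k != q) ==> (enum_val j 0 k == enum_val i 0 k)] =
            [forall k, (k != q) ==> (enum_val i 0 k == enum_val j 0 k)].
    by apply: eq_forallb => k; congr (_ ==> _); apply: eq_sym.
  case: ifP => _; last exact: conjC0.
  rewrite rmorphM rmorphXn rmorphN rmorph1 /= andbC fmorphV; congr (_ / _).
  by apply/CrealP; apply: ger0_real; rewrite sqrtC_ge0.
have HE := Hadamard_ket q : forall x, H *m ket C x = _.
have sum2 (V : nmodType) (F : 'F_2 -> V) : \sum_b F b = F 0 + F 1.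
  by rewrite big_ord_recl big_ord1; congr (F _ + F _); apply: val_inj.
have f0 : flip q 0 = 0 by rewrite /flip scale0r.
have h2 : (sqrtC 2)^-1 * (sqrtC 2)^-1 *+ 2 = 1 :> C.
  by rewrite -[LHS]mulr_natr -invfM -expr2 sqrtCK mulVf // pnatr_eq0.
have HE0 (x : 'rV['F_2]_n) : x 0 q = 0 ->
    H *m ket C x = (sqrtC 2)^-1 *: (ket C x + ket C (x + flip q 1)).
  by move=> xq0; rewrite HE sum2 xq0 f0 !addr0 eqxx /= expr0 !scale1r.
have HE1 (x : 'rV['F_2]_n) : x 0 q = 1 ->
    H *m ket C x = (sqrtC 2)^-1 *: (ket C (x + flip q 1) - ket C x).
  move=> xq1; rewrite HE sum2 xq1 f0 !addr0 oner_eq0 F2_addrr eqxx /=.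
  by rewrite expr0 expr1 scale1r scaleN1r addrC.
have fK (x : 'rV['F_2]_n) : x + flip q 1 + flip q 1 = x by rewrite -addrA F2_rV_addrr addr0.
have fq (x : 'rV['F_2]_n) : (x + flip q 1) 0 q = x 0 q + 1 by rewrite mxE flipE eqxx.
clearbody H; apply: mulmx_ketP => x; rewrite mul1mx -mulmxA.
case: (F2_cases (x 0 q)) => xq.
  apply: proj1 (involution_on_pair h2 (HE0 _ xq) _).
  by rewrite HE1 ?fK // fq xq add0r.
apply: proj2 (involution_on_pair (u := ket C (x + flip q 1)) h2 _ (HE1 _ xq)).
by rewrite HE0 ?fK // fq xq F2_addrr.
Qed.

Lemma CNOT_inj n (c t : 'I_n) : c != t ->
  injective (fun x : 'rV['F_2]_n => x + x 0 c *: delta_mx 0 t).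
Proof.
move=> neq_ct x y eq_xy.
have eq_c : x 0 c = y 0 c.
  move/rowP/(_ c): eq_xy; rewrite !mxE (negPf neq_ct) andbF !mulr0 !addr0.
  by [].
by move: eq_xy; rewrite eq_c => /addIr.
Qed.

Lemma step_wf_cons n (g : gate n) gs : step_wf (Layer (g :: gs)) ->
  uniq (gate_qubits g) /\ step_wf (Layer gs).
Proof. by rewrite /= cat_uniq => /and3P[]. Qed.

Lemma step_mx_unitary n (s : step n) : step_wf s -> step_mx C s \is unitarymx.
Proof.
case: s => [gs|p _]; last first.
  apply: (opmx_fun_unitary (phi := col_perm p)) => x y /rowP eq_xy.
  by apply/rowP=> i; move: (eq_xy (p^-1 i)%g); rewrite !mxE permKV.
elim: gs => [_|g gs IHgs /step_wf_cons[wf_g wf_gs]].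
  by apply/unitarymxP; rewrite trmx1 map_mx1 mulmx1.
apply: mul_unitarymx; first exact: IHgs.
case: g wf_g => [q _|c t /=]; first exact: Hadamard_unitary.
rewrite inE andbT => neq_ct.
exact: opmx_fun_unitary (CNOT_inj neq_ct).
Qed.

Lemma circuit_mx_unitary n (c : circuit n) :
  circuit_wf c -> circuit_mx C c \is unitarymx.
Proof.
elim: c => [_|s c IHc /= /andP[wf_s wf_c]].
  by apply/unitarymxP; rewrite trmx1 map_mx1 mulmx1.
by rewrite mul_unitarymx ?step_mx_unitary ?IHc.
Qed.

Lemma Relabel_ket n (p : {perm 'I_n}) x :
  step_mx C (Relabel p) *m ket C x = ket C (col_perm p x).
Proof. exact: (opmx_fun_ket (col_perm p)). Qed.

Definition supp_in n (P : pred 'I_n) : pred 'rV['F_2]_n :=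
  fun u => [forall j, (u 0 j != 0) ==> P j].

Lemma supp_inP n (P : pred 'I_n) (u : 'rV['F_2]_n) :
  reflect (forall j, ~~ P j -> u 0 j = 0) (supp_in P u).
Proof.
apply: (iffP forallP) => [suppu j nPj | suppu j].
  by apply/eqP; move/implyP/contraR: (suppu j); apply.
by apply/implyP; apply: contraR => /suppu->.
Qed.

(** Zero inputs make every sign trivial. In the induction, a vector supported on [q :: qs] is split
    into its bit at [q] and the rest. *)
Lemma Hadamard_layer_ket n (qs : seq 'I_n) (x : 'rV['F_2]_n) : uniq qs ->
    {in qs, forall q, x 0 q = 0} ->
  step_mx C (Layer [seq Hadamard q | q <- qs]) *m ket C x =
  (sqrtC 2 ^+ size qs)^-1 *:
    \sum_(u : 'rV_n | supp_in (mem qs) u) ket C (x + u).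
Proof.
elim: qs x => [|q qs IHqs] x /=.
  move=> _ _; rewrite mul1mx invr1 scale1r (big_pred1 0) ?addr0 // => u /=.
  apply/supp_inP/eqP => [u0|-> j _]; last by rewrite mxE.
  by apply/rowP=> j; rewrite mxE u0.
case/andP=> q_notin uniq_qs x0.
rewrite -mulmxA Hadamard_ket x0 ?mem_head // eqxx /= -scalemxAr mulmx_sumr.
rewrite exprS invfM -scalerA; congr (_ *: _).
pose phi (w : 'F_2 * 'rV['F_2]_n) := flip q w.1 + w.2.
pose psi (u : 'rV['F_2]_n) := (u 0 q, u - flip q (u 0 q)).
rewrite (reindex_onto phi psi) /=; last first.
  by move=> u _; rewrite /phi /= addrC subrK.
transitivity (\sum_(w | predT w.1 && supp_in (mem qs) w.2)
   (sqrtC 2 ^+ size qs)^-1 *: ket C (x + phi w)).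
  rewrite -(pair_big predT (fun u => supp_in (mem qs) u)
    (fun b u => _ *: ket C (x + phi (b, u)))) /=.
  apply: eq_bigr => b _.
  rewrite expr0 scale1r IHqs ?scaler_sumr //.
    by apply: eq_bigr => u _; rewrite addrA.
  move=> j j_in; rewrite mxE flipE x0 ?inE ?j_in ?orbT //.
  by case: eqP q_notin => [<-|_ _]; rewrite ?j_in ?addr0.
rewrite scaler_sumr; apply: eq_bigl => -[b u] /=; rewrite /phi /psi /=.
have suppE : supp_in (mem qs) u -> u 0 q = 0.
  by move/supp_inP=> supp_u; apply: supp_u.
apply/idP/andP => [supp_u|[supp_bu /eqP[eq_b eq_u]]].
  rewrite mxE flipE eqxx (suppE supp_u) addr0 [_ + u]addrC addrK eqxx.
  split=> //; apply/supp_inP => j; rewrite /= inE negb_or => /andP[neq_j j_notin].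
  rewrite mxE flipE (negPf neq_j) addr0; move/supp_inP: supp_u; exact.
have u_q : u 0 q = 0.
  by move: eq_b; rewrite mxE flipE eqxx => /(canRL (addKr b)); rewrite addNr.
apply/supp_inP=> j j_notin; case: (eqVneq j q) => [->//|neq_jq].
move/supp_inP/(_ j): supp_bu; rewrite mxE flipE (negPf neq_jq) add0r; apply.
by rewrite /= inE negb_or neq_jq.
Qed.

End KetAction.

(** * CNOT circuits *)

Section CnotCircuits.
Variable n : nat.
Implicit Types (g : gate n) (s : step n) (c : circuit n) (x y : 'rV['F_2]_n).

Definition Hadamard_free c :=
  all (fun s => if s is Layer gs then all (@is_CNOT n) gs else true) c.

Definition gate_act g x : 'rV['F_2]_n :=
  if g is CNOT q t then x + x 0 q *: delta_mx 0 t else x.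

Definition step_act s x : 'rV['F_2]_n :=
  match s with
  | Layer gs => foldl (fun x g => gate_act g x) x gs
  | Relabel p => col_perm p x
  end.

Definition circuit_act c x := foldl (fun x s => step_act s x) x c.

Lemma step_act_inj s : step_wf s -> injective (step_act s).
Proof.
case: s => [gs|p _ x y /rowP eq_xy]; last first.
  by apply/rowP=> i; move: (eq_xy (p^-1 i)%g); rewrite !mxE permKV.
elim: gs => [_ x y //|g gs IHgs /step_wf_cons[wf_g /IHgs{}IHgs] x y /= /IHgs].
case: g wf_g => [//|q t /=]; rewrite inE andbT => neq_qt; exact: CNOT_inj.
Qed.

Lemma circuit_act_inj c : circuit_wf c -> injective (circuit_act c).
Proof.
elim: c => [_ x y //|s c IHc /= /andP[wf_s /IHc{}IHc] x y /IHc].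
exact: step_act_inj.
Qed.

Lemma circuit_act_ket (C : numClosedFieldType) c x : Hadamard_free c ->
  circuit_mx C c *m ket C x = ket C (circuit_act c x).
Proof.
elim: c x => [|s c IHc] x /=; first by rewrite mul1mx.
case/andP=> Hs Hc; rewrite -mulmxA.
suff -> : step_mx C s *m ket C x = ket C (step_act s x) by rewrite IHc.
case: s Hs => [gs|p _]; last exact: Relabel_ket.
elim: gs x => [|g gs IHgs] x /=; first by rewrite mul1mx.
case/andP=> Hg Hgs; rewrite -mulmxA; case: g Hg => // q t _.
by rewrite (opmx_fun_ket C (fun x => x + x 0 q *: delta_mx 0 t)) IHgs.
Qed.

End CnotCircuits.

(** * Layers of CNOT gates on labelled qubits *)

(* [(t, c)] is the layer with a gate from control [c P] to target [P] for each
   [P] in [t]. *)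
Definition cnot_layer (Q : finType) : Type := (pred Q * (Q -> Q))%type.

Section Layers.
Variable Q : finType.
Implicit Types (l : cnot_layer Q) (ls : seq (cnot_layer Q)).
Implicit Types x y : {ffun Q -> 'F_2}.

Definition lay l x : {ffun Q -> 'F_2} :=
  [ffun P => x P + (if l.1 P then x (l.2 P) else 0)].

Definition run ls x := foldl (fun x l => lay l x) x ls.

Lemma run_rcons ls l x : run (rcons ls l) x = lay l (run ls x).
Proof. by rewrite /run foldl_rcons. Qed.

Lemma layD l x y : lay l (x + y) = lay l x + lay l y.
Proof. by apply/ffunP=> P; rewrite !ffunE; case: ifP; rewrite ?addr0 // addrACA. Qed.

Lemma layK l : (forall P, l.1 P -> ~~ l.1 (l.2 P)) -> involutive (lay l).
Proof.
move=> free x; apply/ffunP=> P; rewrite !ffunE.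
case: ifP => [tP|_]; last by rewrite !addr0.
by rewrite (negPf (free P tP)) addr0 -addrA F2_addrr addr0.
Qed.

Lemma runD ls x y : run ls (x + y) = run ls x + run ls y.
Proof. by elim: ls x y => //= l ls IHls x y; rewrite /run /= layD -IHls. Qed.

(** No control is a target of an earlier layer, so each control still holds its input value and the
    increments add up, even if several reach the same target. *)
Lemma run_once (K : eqType) (L : K -> cnot_layer Q) ks x :
    pairwise (fun k k' => [forall P, (L k').1 P ==> ~~ (L k).1 ((L k').2 P)]) ks ->
  forall P, run (map L ks) x P =
    x P + \sum_(k <- ks) (if (L k).1 P then x ((L k).2 P) else 0).
Proof.
elim: ks x => [|k ks IHks] x /=; first by move=> _ P; rewrite big_nil addr0.
case/andP=> /allP fresh pw P; rewrite big_cons addrA IHks // ffunE; congr (_ + _).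
apply: eq_big_seq => k' /fresh/forallP/(_ P); case: ifP => // _ /negPf fresh_k.
by rewrite ffunE fresh_k addr0.
Qed.

(* The slot [T] carries no qubit. *)
Definition layer_ok (T : Q) l := forall P, l.1 P ->
  [/\ P != T, l.2 P != T, ~~ l.1 (l.2 P) &
      forall P', l.1 P' -> l.2 P = l.2 P' -> P = P'].

Variables (n : nat) (T : Q) (f : 'I_n -> Q) (g : Q -> 'I_n).
Hypothesis fK : cancel f g.
Hypothesis gK : forall P, P != T -> f (g P) = P.

Definition read x : 'rV['F_2]_n := \row_j x (f j).

Definition layer_gates l : step n :=
  Layer [seq CNOT (g (l.2 P)) (g P) | P <- enum l.1].

Lemma g_inj : {in predC1 T &, injective g}.
Proof. by move=> P P' nTP nTP' eq_g; rewrite -[P]gK // eq_g gK. Qed.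

Lemma layer_gates_wf l : layer_ok T l -> step_wf (layer_gates l).
Proof.
move=> ok_l; rewrite /= -map_comp.
set s := enum l.1; have s_l P : P \in s -> l.1 P by rewrite mem_enum.
have -> : uniq (flatten [seq gate_qubits (CNOT (g (l.2 P)) (g P)) | P <- s]) =
          uniq (map g (map l.2 s ++ s)).
  apply: perm_uniq; elim: (s) => //= P s' IHs'.
  rewrite map_cat /= -cat1s -[_ :: map _ _ ++ _]cat1s perm_cat2l.
  by rewrite -[_ :: map g s']cat1s perm_sym perm_catCA perm_cat2l perm_sym -map_cat.
rewrite map_inj_in_uniq => [|P P']; last first.
  have nT R : R \in map l.2 s ++ s -> R \in predC1 T.
    by rewrite mem_cat => /orP[/mapP[R' /s_l/ok_l[_ ? _ _] ->]|/s_l/ok_l[]].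
  by move=> /nT ? /nT ? ; apply: g_inj.
rewrite cat_uniq enum_uniq andbT map_inj_in_uniq ?enum_uniq.
  apply/hasPn=> P /s_l lP; apply/mapP=> -[P' /s_l/ok_l[_ _ + _] eq_P].
  by rewrite -eq_P lP.
by move=> P P' /s_l/ok_l[_ _ _ inj_l] /s_l /inj_l.
Qed.

Lemma gate_act_read P c x : P != T -> c != T ->
  gate_act (CNOT (g c) (g P)) (read x) = read (lay (xpred1 P, fun=> c) x).
Proof.
move=> nTP nTc; apply/rowP=> j; rewrite !mxE ffunE /= gK //; congr (_ + _).
have -> : (j == g P) = (f j == P).
  by apply/eqP/eqP => [->|<-]; rewrite ?gK ?fK.
by case: eqP => _; rewrite ?mulr1 ?mulr0.
Qed.

Lemma step_act_read l x :
  layer_ok T l -> step_act (layer_gates l) (read x) = read (lay l x).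
Proof.
move=> ok_l; rewrite /layer_gates /=.
set s := enum l.1; have s_l P : P \in s -> l.1 P by rewrite mem_enum.
pose single P : cnot_layer Q := (xpred1 P, fun=> l.2 P).
(* The gates are applied one at a time; since no control of the layer is one of its targets,
   [run_once] shows that this is the simultaneous action. *)
transitivity (read (run (map single s) x)).
  elim: (s) s_l x => //= P s' IHs' s'_l x.
  have /ok_l[nTP nTc _ _] := s'_l P (mem_head _ _).
  have /= -> := gate_act_read x nTP nTc; rewrite IHs' // => R R_in.
  by rewrite s'_l // inE R_in orbT.
congr read; apply/ffunP=> R; rewrite run_once ?ffunE; last first.
  elim: (s) s_l => //= P s' IHs' s'_l; rewrite IHs' ?andbT; last first.
    by move=> R' R'_in; rewrite s'_l // inE R'_in orbT.
  apply/allP=> P' P'_in; apply/forallP=> R'; apply/implyP=> _ /=.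
  have /ok_l[_ _ + _] : l.1 P' by rewrite s'_l // inE P'_in orbT.
  by apply: contraNneq => ->; rewrite s'_l ?mem_head.
congr (_ + _); have uniq_s : uniq s by apply: enum_uniq.
case: ifPn => [lR|nlR]; last first.
  apply: big1_seq => P /andP[_ /s_l] /=.
  by case: (eqVneq R P) => [<-|//]; rewrite (negPf nlR).
rewrite (bigD1_seq R) ?mem_enum //= eqxx big1 ?addr0 // => P neq_PR.
by rewrite eq_sym (negPf neq_PR).
Qed.

(** The labelling [f] of the qubits is a parameter: two circuits in a row may use different
    labellings of the same qubits, and passing from one to the other costs nothing. *)
Lemma layers_circuit (K : eqType) (L : K -> cnot_layer Q) ks :
    {in ks, forall k, layer_ok T (L k)} ->
  exists c : circuit n, [/\ circuit_wf c, Hadamard_free c, depth c = size ks,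
      CNOT_count c = (\sum_(k <- ks) #|(L k).1|)%N &
      forall x, circuit_act c (read x) = read (run (map L ks) x)].
Proof.
move=> ok_ks; exists [seq layer_gates (L k) | k <- ks].
elim: ks ok_ks => [|k ks IHks] ok_ks /=; first by rewrite big_nil.
have ok_k := ok_ks k (mem_head _ _).
have [k' k'_in|wf_c free_c d_c n_c act_c] := IHks.
  by apply: ok_ks; rewrite inE k'_in orbT.
split.
- by apply/andP; split; first exact: layer_gates_wf.
- by rewrite /= free_c andbT all_map; apply/allP.
- by rewrite /depth /= -/(depth _) d_c.
- by rewrite /CNOT_count /= -/(CNOT_count _) n_c big_cons count_map count_predT cardE.
by move=> x; rewrite /circuit_act /= -act_c -step_act_read.
Qed.

End Layers.

(** * The encoding circuit on the slots *)

(* A slot is a set of variables. It starts with the coefficient of its monomial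
   and, once all variables are processed, holds the value at its indicator
   point. The polynomials have no monomial [from k0], so this slot carries no
   qubit at the start; the value at the origin is punctured, so the slot [set0]
   carries none at the end. *)

Section Slots.
Variables (k0 rd : nat).
Local Notation m := (k0 + rd).+1.
Local Notation Q := {set 'I_m}.
Implicit Types (k j : nat) (P A : Q) (x y z u : {ffun Q -> 'F_2}).

Definition var k : 'I_m := inord k.
Definition below k : Q := [set i : 'I_m | (i < k)%N].
Definition from k : Q := [set i : 'I_m | (k <= i)%N].

Definition target k (phi psi : pred Q) : pred Q :=
  fun P => [&& var k \in P, phi (P :&: below k) & psi (P :&: from k.+1)].

Definition drop_var k P : Q := P :\ var k.

Lemma var_val k (i : 'I_m) : (k < m)%N -> (i == var k) = (i == k :> nat).
Proof. by move=> lt_km; rewrite -val_eqE /= inordK. Qed.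

Lemma drop_var_below k P : (k < m)%N -> drop_var k P :&: below k = P :&: below k.
Proof.
move=> lt_km; apply/setP=> i; rewrite !inE var_val //.
by case: ltngtP; rewrite ?andbF.
Qed.

Lemma drop_var_from k P :
  (k < m)%N -> drop_var k P :&: from k.+1 = P :&: from k.+1.
Proof.
move=> lt_km; apply/setP=> i; rewrite !inE var_val //.
by case: ltngtP; rewrite ?andbF.
Qed.

Lemma var_drop_var k P : var k \in drop_var k P = false.
Proof. by rewrite !inE eqxx. Qed.

Lemma drop_var_inj k P P' :
  var k \in P -> var k \in P' -> drop_var k P = drop_var k P' -> P = P'.
Proof. by move=> kP kP' eqP; rewrite -(setD1K kP) -(setD1K kP') -/(drop_var k P) eqP. Qed.

Lemma from_fromS k P : (k < m)%N ->
  #|P :&: from k| = ((var k \in P) + #|P :&: from k.+1|)%N.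
Proof.
move=> lt_km; rewrite (cardsD1 (var k)) !inE inordK // leqnn andbT; congr (_ + _)%N.
apply: eq_card => i; rewrite !inE var_val //.
by case: ltngtP; rewrite ?andbF.
Qed.

Lemma card_from k : (k <= m)%N -> #|from k| = (m - k)%N.
Proof.
have [d] := ubnP (m - k); elim: d k => // d IHd k lt_d le_km.
have [eq_km|lt_km] := eqVneq k m.
  rewrite eq_km subnn; apply: eq_card0 => i; rewrite inE leqNgt.
  by rewrite ltn_ord.
have {}lt_km : (k < m)%N by rewrite ltn_neqAle lt_km.
have := from_fromS setT lt_km; rewrite !setTI inE => ->.
by rewrite IHd // ?add1n -subSn ?subSS //; apply: leq_trans lt_d; rewrite ltn_sub2l.
Qed.

Lemma from_eq0 k : (k <= m)%N -> (from k == set0) = (k == m).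
Proof.
move=> le_km; rewrite -cards_eq0 card_from // subn_eq0.
by rewrite eqn_leq le_km.
Qed.

Lemma from_inj : {in [pred k | (k <= m)%N] &, injective from}.
Proof.
move=> k k' le_k le_k' /(congr1 (fun A : Q => #|A|)).
rewrite !card_from // => eq_sub.
by rewrite -(subKn le_k) eq_sub subKn.
Qed.

Lemma drop_var_fromE k : (k < m)%N -> drop_var k (from k) = from k.+1.
Proof.
by move=> lt_km; apply/setP=> i; rewrite !inE var_val //; case: ltngtP.
Qed.

(* [filled j P A] says that the value at [P], with the variables below [j]
   evaluated, receives a contribution of the coefficient of [A]. *)
Definition filled j P A :=
  [forall i : 'I_m, if i \in A then i \in P else (i \in P) ==> (i < j)%N].

Definition partial_eval j x P := \sum_(A | filled j P A) x A.

Lemma filled_mem j P A : (j < m)%N -> var j \in P ->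
  filled j.+1 P A && (var j \in A) = filled j P A.
Proof.
move=> lt_jm jP; apply/andP/forallP => [[/forallP fill jA] i|fill].
  have := fill i; case: ifPn => // nA; case: (i \in P) => //=.
  rewrite ltnS leq_eqVlt -var_val // => /orP[/eqP eq_i|//].
  by rewrite eq_i jA in nA.
split.
  apply/forallP=> i; have := fill i; case: ifP => // _ /implyP fill_i.
  by apply/implyP=> /fill_i /leqW.
by have := fill (var j); case: ifP => // _; rewrite jP inordK // ltnn.
Qed.

Lemma filled_drop j P A : (j < m)%N -> var j \in P ->
  filled j.+1 P A && (var j \notin A) = filled j (drop_var j P) A.
Proof.
move=> lt_jm jP; apply/andP/forallP => [[/forallP fill jA] i|fill].
  rewrite !inE; have := fill i; case: ifPn => [iA ->|nA].
    by rewrite andbT; apply: contraNneq jA => <-.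
  case: (i \in P) => /=; rewrite ?andbF // andbT ltnS leq_eqVlt var_val //.
  by case: eqP.
have njA : var j \notin A.
  by apply/negP=> jA; have := fill (var j); rewrite jA var_drop_var.
split=> //; apply/forallP=> i; have := fill i; rewrite !inE.
case: ifP => [_ /andP[]//|_].
rewrite var_val // [(i < j.+1)%N]ltnS [(i <= j)%N]leq_eqVlt.
by case: (i == j :> nat) => //=; rewrite implybT.
Qed.

Lemma partial_evalS j x P : (j < m)%N ->
  partial_eval j.+1 x P = partial_eval j x P +
    (if var j \in P then partial_eval j x (drop_var j P) else 0).
Proof.
move=> lt_jm; rewrite /partial_eval; case: ifPn => [jP|njP].
  rewrite (bigID (fun A => var j \in A)) /=; congr (_ + _); apply: eq_bigl => A.
    exact: filled_mem.
  exact: filled_drop.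
rewrite addr0; apply: eq_bigl => A; apply: eq_forallb => i.
case: ifP => // _; case: (boolP (i \in P)) => //= iP; rewrite ltnS leq_eqVlt.
case: (eqVneq (i : nat) j) => // /eqP; rewrite -var_val // => /eqP eq_ij.
by rewrite -eq_ij iP in njP.
Qed.

Lemma partial_eval_from j x P : P \subset from j -> partial_eval j x P = x P.
Proof.
move=> /subsetP sPj; rewrite /partial_eval (big_pred1 P) // => A.
apply/forallP/eqP => [fill|-> i]; last by case: (i \in P).
apply/setP=> i; have := fill i; case: ifP => // _.
case: (boolP (i \in P)) => //= /sPj; rewrite inE leqNgt.
by move=> /negPf->.
Qed.

Lemma partial_eval_all x P : partial_eval m x P = \sum_(A : Q | A \subset P) x A.
Proof.
apply: eq_bigl => A; apply/forallP/subsetP => [fill i iA|sAP i].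
  by have := fill i; rewrite iA.
by case: ifP => [/sAP //|_]; rewrite ltn_ord implybT.
Qed.

Lemma partial_eval0 j x P :
  (forall A, filled j P A -> x A = 0) -> partial_eval j x P = 0.
Proof. by move=> x0; rewrite /partial_eval big1. Qed.

Lemma target_free k phi psi P :
  target k phi psi P -> ~~ target k phi psi (drop_var k P).
Proof. by rewrite /target var_drop_var. Qed.

Lemma target_layer_ok T k phi psi :
    (forall P, target k phi psi P -> P != T /\ drop_var k P != T) ->
  layer_ok T (target k phi psi, drop_var k).
Proof.
move=> avoid P tP; have [nT dT] := avoid P tP; split=> //=.
  exact: target_free tP.
by move=> P' /and3P[kP' _ _]; apply: drop_var_inj => //; case/and3P: tP.
Qed.

(** At [k = k0] the block of the subsets of [from k0], which contains the punctured point, is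
    skipped and left to the chain layers. *)
Definition full_layer k : cnot_layer Q :=
  (target k (fun a => (k < k0)%N || (a != set0)) predT, drop_var k).

Lemma full_layerE k x P : (k < k0)%N ->
  lay (full_layer k) x P = x P + (if var k \in P then x (drop_var k P) else 0).
Proof. by move=> lt_k; rewrite ffunE /= /target lt_k andbT. Qed.

Lemma iotaSr k n : iota k n.+1 = rcons (iota k n) (k + n)%N.
Proof. by rewrite -addn1 iotaD cats1. Qed.

Lemma run_full k x P : (k <= k0)%N ->
  run (map full_layer (iota 0 k)) x P = partial_eval k x P.
Proof.
elim: k P => [|k IHk] P le_k.
  rewrite partial_eval_from //; apply/subsetP=> i _.
  by rewrite inE.
have lt_km : (k < m)%N by rewrite ltnS (leq_trans (ltnW le_k)) ?leq_addr.
rewrite iotaSr map_rcons run_rcons full_layerE // partial_evalS //.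
by rewrite !IHk // ltnW.
Qed.

Lemma lt_k0m : (k0 < m)%N. Proof. by rewrite ltnS leq_addr. Qed.

Lemma run_full_last x P : run (map full_layer (iota 0 k0.+1)) x P =
  partial_eval (if P :&: below k0 == set0 then k0 else k0.+1) x P.
Proof.
rewrite iotaSr map_rcons run_rcons ffunE /= /target ltnn /= andbT.
rewrite !run_full //; case: (P :&: below k0 == set0); first by rewrite andbF addr0.
by rewrite andbT partial_evalS ?lt_k0m.
Qed.

(** * Pruning the first layers *)

Variable r : nat.

(** The lower bound drops by one per variable, as [r] does in the recursion for zeta; its truncation
    at 0 matches the passage to [zeta_c], whose sums start at 0. *)
Definition pruned_layer k : cnot_layer Q :=
  (target k (fun a => (k < k0)%N || (a != set0))
     (fun b => (r - k <= #|b| <= rd)%N), drop_var k).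

Definition low_degree x := forall A, (rd < #|A|)%N -> x A = 0.

Definition superposed x := forall A, ~~ (0 < #|A| <= r)%N -> x A = 0.

Lemma full_layerK k : involutive (lay (full_layer k)).
Proof. by apply: layK => P; apply: target_free. Qed.

(** Full layers are involutions, so [u] is found by undoing them from the last. The support
    condition survives: when [k] drops by one, [#|P :&: from k|] grows by at most one, and at
    [k = 0] the condition says that [z] is superposed. *)
Lemma full_layer_onto k z : (k <= k0)%N ->
    (forall P, z P != 0 -> P != set0 /\ (#|P :&: from k| + k <= r)%N) ->
  exists2 u, superposed u & run (map full_layer (iota 0 k)) u = z.
Proof.
elim: k z => [|k IHk] z le_k small_z.
  exists z => // A; apply: contraNeq => /small_z[nz_A].
  rewrite addn0 card_gt0 nz_A; suff -> : A :&: from 0 = A by [].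
  by apply/setIidPl/subsetP=> i _; rewrite inE.
have lt_km : (k < m)%N by rewrite ltnS (leq_trans (ltnW le_k)) ?leq_addr.
have [|P|u sup_u eq_u] := IHk (lay (full_layer k) z); first exact: ltnW.
  have le_from R : (#|R :&: from k| + k <= #|R :&: from k.+1| + k.+1)%N.
    by rewrite from_fromS //; case: (_ \in _); lia.
  rewrite full_layerE //; case: (eqVneq (z P) 0) => [->|/small_z[nz_P le_P] _].
    rewrite add0r; case: ifP => [kP /small_z[_]|_]; last by rewrite eqxx.
    rewrite drop_var_from // => /(leq_trans (le_from P)) ->; split=> //.
    by apply: contraTneq kP => ->; rewrite inE.
  by split=> //; apply: leq_trans le_P.
exists u => //; rewrite iotaSr map_rcons run_rcons eq_u.
exact: full_layerK.
Qed.

(** Only the coefficients of sets [A] containing [P :&: from k] reach the slot [P], and these have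
    degree above [rd]. *)
Lemma run_full_high k x P : (k <= k0)%N -> low_degree x ->
  (rd < #|P :&: from k|)%N -> run (map full_layer (iota 0 k)) x P = 0.
Proof.
move=> le_k low_x hi_P; rewrite run_full //; apply: partial_eval0 => A fill.
apply: low_x; apply: leq_trans hi_P _; apply: subset_leq_card.
apply/subsetP=> i; rewrite !inE => /andP[iP le_ki].
have /forallP/(_ i) := fill; case: ifP => // _.
by rewrite iP /= ltnNge le_ki.
Qed.

Section Superposition.
Hypothesis le_rd : (r <= rd)%N.

Lemma superposed_low x : superposed x -> low_degree x.
Proof.
by move=> sup_x A hi_A; apply: sup_x; lia.
Qed.

Lemma superposedD x y : superposed x -> superposed y -> superposed (x + y).
Proof. by move=> sx sy A nA; rewrite ffunE sx // sy // addr0. Qed.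

Lemma low_degreeD x y : low_degree x -> low_degree y -> low_degree (x + y).
Proof. by move=> lx ly A hA; rewrite ffunE lx // ly // addr0. Qed.

(* A gate is pruned if its control is zero, or if its target lies in the space
   over which the state is superposed. *)
Lemma run_pruned k x : (k <= k0.+1)%N -> low_degree x ->
  exists2 u, superposed u &
    run (map pruned_layer (iota 0 k)) x = run (map full_layer (iota 0 k)) (x + u).
Proof.
move=> le_k low_x; elim: k le_k => [_|k IHk le_k].
  by exists 0 => [A _|]; rewrite ?ffunE // addr0.
have [u sup_u eq_u] := IHk (ltnW le_k); have le_kk0 : (k <= k0)%N by [].
have lt_km : (k < m)%N := leq_ltn_trans le_kk0 lt_k0m.
set y := run (map full_layer (iota 0 k)) (x + u).
(* The sum of the two layers is the error made by the gates left out at this step; it is pulled back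
   to a superposed input [v]. *)
have [||v sup_v eq_v] := @full_layer_onto k
    (lay (pruned_layer k) y + lay (full_layer k) y) => //.
  move=> P; rewrite !ffunE addrACA F2_addrr add0r /= /target andbT.
  case: (boolP (_ && _)) => [/and3P[-> -> /=]|]; last first.
    case: ifP => [/andP[kP ->] /=|_]; last by rewrite addr0 eqxx.
    rewrite kP /= add0r negb_and -!ltnNge => /orP[lt_P _|hi_P].
      split; first by apply: contraTneq kP => ->; rewrite inE.
      by rewrite from_fromS // kP; move: #|_| lt_P => c; lia.
    rewrite /y run_full_high ?eqxx //.
      by apply: low_degreeD => //; apply: superposed_low.
    by rewrite from_fromS // var_drop_var drop_var_from.
  by rewrite F2_addrr eqxx.
exists (u + v); first exact: superposedD.
rewrite !iotaSr !map_rcons !run_rcons eq_u addrA -/y runD -/y eq_v layD.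
apply/ffunP=> P; rewrite [RHS]ffunE; set z := _ + _ in eq_v *.
(* The error lives on sets containing [var k], while the layer reads only sets without it. So the
   layer fixes the error, which may be added before it. *)
suff -> : lay (full_layer k) z = z.
  have -> : z P = lay (pruned_layer k) y P + lay (full_layer k) y P.
    by rewrite /z ffunE.
  by rewrite addrCA F2_addrr addr0.
apply/ffunP=> R; rewrite ffunE /= /target; case: ifP => [/and3P[kR _ _]|_].
  by rewrite /z !ffunE /= /target var_drop_var /= !addr0 F2_addrr addr0.
exact: addr0.
Qed.

End Superposition.

(** * The punctured block *)

(* On the monomials in the variables [from k0] the value at [P] needs the sum of
   the coefficients of [P] and of [P] without its first variable. These sums
   form a tree whose nodes are the sets; along the path of the sets [from k] it
   is rooted at [from k0.+1] instead of [set0], which makes the slot [from k0]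
   superfluous and leaves the sum of [from k] in the slot [from k.+1]. *)
Definition split_layer k : cnot_layer Q :=
  (target k (pred1 set0) (predC1 (from k.+1)), drop_var k).

Definition shift_layer k : cnot_layer Q :=
  (xpred1 (from k.+1), fun=> from k).

Definition chain_layer (bk : bool * nat) : cnot_layer Q :=
  if bk.1 then split_layer bk.2 else shift_layer bk.2.

Definition chain_seq : seq (bool * nat) :=
  [seq (true, k) | k <- iota k0 rd.+1] ++
  [seq (false, k) | k <- rev (iota k0.+1 rd)].

Lemma from_subset k j : (k <= j)%N -> from j \subset from k.
Proof. by move=> le_kj; apply/subsetP=> i; rewrite !inE; apply: leq_trans. Qed.

Lemma from_below k j : (j <= k)%N -> from k :&: below j = set0.
Proof. by move=> le_jk; apply/setP=> i; rewrite !inE; lia. Qed.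

Lemma mem_var_from k j : (k < m)%N -> (var k \in from j) = (j <= k)%N.
Proof. by move=> lt_km; rewrite inE inordK. Qed.

Lemma below_set0 k P : (P :&: below k == set0) = (P \subset from k).
Proof.
apply/eqP/subsetP => [/setP P0 i iP|sPk].
  by rewrite inE leqNgt; have := P0 i; rewrite !inE iP /= => ->.
apply/setP=> i; rewrite !inE; case: (boolP (i \in P)) => //= /sPk.
by rewrite inE leqNgt => /negPf.
Qed.

Lemma lead_from k j : (k < m)%N -> var k \in from j -> from j \subset from k ->
  j = k.
Proof.
move=> lt_km; rewrite mem_var_from // => le_jk /subsetP sub_jk.
apply/eqP; rewrite eqn_leq le_jk /=.
have lt_jm : (j < m)%N by apply: leq_ltn_trans lt_km.
by have := sub_jk (var j); rewrite !mem_var_from //; apply.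
Qed.

Lemma split_layer_from k j : (j < m)%N -> (split_layer j).1 (from k) = false.
Proof.
move=> lt_jm; apply/negP=> /and3P[]; rewrite mem_var_from // => le_kj _ /=.
by rewrite (setIidPr (from_subset (leqW le_kj))) eqxx.
Qed.

Lemma mem_chain_iota k : (k \in iota k0 rd.+1) = (k0 <= k < m)%N.
Proof. by rewrite mem_iota addnS. Qed.

Lemma mem_shift_iota k : (k \in iota k0.+1 rd) = (k0 < k < m)%N.
Proof. by rewrite mem_iota addSn. Qed.

(** This dictates the order of [chain_seq]. A split gate reads a set whose variables all come after
    [var k], so ascending [k] reads it before it becomes a target. The sets on the path are never
    split targets, and descending [k] reads [from k] before the shift into it. *)
Lemma chain_pairwise : pairwise (fun a b =>
  [forall P, (chain_layer b).1 P ==> ~~ (chain_layer a).1 ((chain_layer b).2 P)])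
  chain_seq.
Proof.
rewrite pairwise_cat !pairwise_map; apply/and3P; split.
- apply/allrelP=> _ _ /mapP[j + ->] /mapP[k _ ->].
  rewrite mem_chain_iota => /andP[_ lt_jm]; apply/forallP=> P.
  by apply/implyP=> _; rewrite split_layer_from.
- have := iota_ltn_sorted k0 rd.+1; rewrite (sorted_pairwise ltn_trans).
  apply: (@sub_in_pairwise _ (mem (iota k0 rd.+1))); last by apply/allP.
  move=> j k; rewrite !mem_chain_iota => /andP[_ lt_jm] /andP[_ lt_km] lt_jk.
  apply/forallP=> P; apply/implyP=> /and3P[_ /= P0 _].
  apply/negP=> /and3P[]; rewrite !inE => /andP[_ jP] _ _.
  move: P0; rewrite below_set0 => /subsetP/(_ _ jP); rewrite mem_var_from //.
  by rewrite leqNgt lt_jk.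
have : sorted gtn (rev (iota k0.+1 rd)).
  by rewrite rev_sorted; apply: iota_ltn_sorted.
rewrite sorted_pairwise; last by move=> j i k /= lt_ji lt_kj; apply: ltn_trans lt_ji.
apply: (@sub_in_pairwise _ (mem (iota k0.+1 rd))); last first.
  by apply/allP=> k; rewrite mem_rev.
move=> j k; rewrite !mem_shift_iota => /andP[_ lt_jm] /andP[_ lt_km] /= lt_kj.
apply/forallP=> P; apply/implyP=> _ /=; apply/eqP => /from_inj.
by rewrite !inE => /(_ (ltnW lt_km) lt_jm) eq_kj; rewrite eq_kj ltnNge leqnSn in lt_kj.
Qed.

Lemma run_chainE y P : run (map chain_layer chain_seq) y P = y P +
  (\sum_(k <- iota k0 rd.+1)
      (if (split_layer k).1 P then y (drop_var k P) else 0) +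
   \sum_(k <- iota k0.+1 rd) (if P == from k.+1 then y (from k) else 0)).
Proof.
rewrite run_once ?chain_pairwise // /chain_seq big_cat !big_map; congr (_ + (_ + _)).
by apply: perm_big; rewrite perm_rev.
Qed.

Lemma run_chain_low y P : P :&: below k0 != set0 ->
  run (map chain_layer chain_seq) y P = y P.
Proof.
rewrite below_set0 => low_P; rewrite run_chainE !big1_seq ?addr0 // => k /=.
  rewrite mem_shift_iota => /andP[lt_k _]; case: eqP => // eq_P.
  by rewrite eq_P from_subset // ltnW // ltnW in low_P.
rewrite mem_chain_iota => /andP[le_k _]; case: ifP => // /and3P[_ /=].
rewrite below_set0 => /subset_trans/(_ (from_subset le_k)) sP.
by rewrite sP in low_P.
Qed.

Lemma run_chain_lead y k P : (k0 <= k < m)%N -> var k \in P -> P \subset from k ->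
  P != from k -> run (map chain_layer chain_seq) y P = y P + y (drop_var k P).
Proof.
move=> /andP[le_k lt_km] kP sPk neq_P.
have lead j : (j < m)%N -> var j \in P -> P \subset from j -> j = k.
  move=> lt_jm jP /subsetP sPj; apply/eqP; rewrite eqn_leq.
  have := subsetP sPk _ jP; rewrite mem_var_from // => ->.
  by have := sPj _ kP; rewrite mem_var_from // => ->.
rewrite run_chainE [X in _ + (_ + X)]big1_seq ?addr0 => [|j /andP[_]]; last first.
  rewrite mem_shift_iota => /andP[lt_j lt_jm]; case: eqP => // eq_P.
  have eq_jk : j.+1 = k by apply: lead_from; rewrite -?eq_P.
  by rewrite eq_P eq_jk eqxx in neq_P.
congr (_ + _); rewrite (bigD1_seq k) ?iota_uniq ?mem_chain_iota ?le_k //=.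
rewrite big1_seq ?addr0 => [|j /andP[neq_jk]]; last first.
  rewrite mem_chain_iota => /andP[_ lt_jm]; case: ifP => // /and3P[jP /=].
  by rewrite below_set0 => /(lead _ lt_jm jP) eq_jk; rewrite eq_jk eqxx in neq_jk.
rewrite /target kP /= below_set0 sPk /=; case: eqP => // eq_P.
case/eqP: neq_P; apply: (@drop_var_inj k) => //; first by rewrite mem_var_from.
rewrite drop_var_fromE // -eq_P -drop_var_from //.
symmetry; apply/setIidPl/subsetP=> i; rewrite !inE var_val // => /andP[neq_ik iP].
by have := subsetP sPk _ iP; rewrite inE leq_eqVlt eq_sym (negPf neq_ik).
Qed.

(** For [k = k0] there is no shift gate, and the zero coefficient of [from k0] makes up for it. For
    [k.+1 = m] the sum lands in [from m = set0], the former slot of the constant coefficient. *)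
Lemma run_chain_from y k : (k0 <= k < m)%N -> y (from k0) = 0 ->
  run (map chain_layer chain_seq) y (from k.+1) = y (from k.+1) + y (from k).
Proof.
move=> /andP[le_k lt_km] y0; rewrite run_chainE big1_seq ?add0r => [|j /andP[_]].
  congr (_ + _); have [eq_k|neq_k] := eqVneq k k0.
    rewrite eq_k y0 big1_seq // => j /andP[_].
    rewrite mem_shift_iota => /andP[lt_j lt_jm]; case: eqP => // /from_inj.
    by rewrite !inE => /(_ lt_k0m lt_jm) [eq_j]; rewrite eq_j ltnn in lt_j.
  rewrite (bigD1_seq k) ?iota_uniq ?mem_shift_iota //=; last first.
    by rewrite ltn_neqAle eq_sym neq_k le_k.
  rewrite eqxx big1_seq ?addr0 // => j /andP[neq_jk].
  rewrite mem_shift_iota => /andP[_ lt_jm]; case: eqP => // /from_inj.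
  by rewrite !inE => /(_ lt_km lt_jm) [eq_j]; rewrite eq_j eqxx in neq_jk.
by rewrite mem_chain_iota => /andP[_ lt_jm]; rewrite split_layer_from.
Qed.

(* The physical slot holding the value at [P] after the chain layers. *)
Definition slot P : Q :=
  if P == set0 then from k0 else
  if (k0 <= m - #|P|)%N && (P == from (m - #|P|)) then from (m - #|P|).+1 else P.

Variant slot_spec P : Q -> Type :=
  | SlotEmpty of P = set0 : slot_spec P (from k0)
  | SlotFrom k of (k0 <= k < m)%N & P = from k : slot_spec P (from k.+1)
  | SlotId of P != set0 & (forall k, (k0 <= k < m)%N -> P != from k) :
      slot_spec P P.

Lemma slotP P : slot_spec P (slot P).
Proof.
rewrite /slot; case: eqP => [P0|/eqP nP0]; first exact: SlotEmpty.
have lt_km : (m - #|P| < m)%N by rewrite ltn_subrL card_gt0 nP0.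
case: ifPn => [/andP[le_k /eqP eq_P]|not_from].
  by apply: SlotFrom => //; rewrite le_k.
apply: SlotId => // k /andP[le_k lt_k]; apply: contraNneq not_from => ->.
by rewrite card_from ?subKn ?le_k ?eqxx // ltnW.
Qed.

(** [slot] is the cyclic shift along the path [from k0], ..., [from m = set0], and the identity
    elsewhere. *)
Lemma slot_inj : injective slot.
Proof.
have fromI k k' : (k <= m)%N -> (k' <= m)%N -> from k = from k' -> k = k'.
  by move=> le_k le_k'; apply: from_inj.
have k0_ok : (k0 <= k0 < m)%N by rewrite leqnn lt_k0m.
have idF k P : (k0 <= k < m)%N -> P != set0 ->
    (forall k, (k0 <= k < m)%N -> P != from k) -> from k.+1 <> P.
  move=> /andP[le_k lt_k] nP0 nP eq_P; have [lt_Sk|] := ltnP k.+1 m.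
    by have := nP k.+1; rewrite eq_P eqxx (leqW le_k) lt_Sk => /(_ isT).
  move=> le_m; have eq_m : k.+1 = m by apply/eqP; rewrite eqn_leq lt_k.
  by rewrite -eq_P from_eq0 // eq_m eqxx in nP0.
move=> P P'; case: slotP => [->|k ok_k ->|nP0 nP]; case: slotP => [->|k' ok_k' ->|nP0' nP'].
- by [].
- case/andP: ok_k' => le_k' lt_k' /fromI eq_k.
  by have := eq_k (ltnW lt_k0m) lt_k'; lia.
- by move=> eq_P; have := nP' _ k0_ok; rewrite eq_P eqxx.
- case/andP: ok_k => le_k lt_k /esym/fromI eq_k.
  by have := eq_k (ltnW lt_k0m) lt_k; lia.
- case/andP: ok_k => _ lt_k; case/andP: ok_k' => _ lt_k'.
  by move/fromI => /(_ lt_k lt_k')[->].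
- by move/(idF _ _ ok_k nP0' nP').
- by move=> eq_P; have := nP _ k0_ok; rewrite -eq_P eqxx.
- by move/esym/(idF _ _ ok_k' nP0 nP).
by [].
Qed.

Lemma slot_neq P : P != set0 -> slot P != from k0.
Proof.
by apply: contraNneq => eq_P; apply/eqP/slot_inj; rewrite eq_P /slot eqxx.
Qed.

(** * Evaluation inside the blocks *)

(** A set with first variable [k] is skipped: the chain layers have already added that contribution.
    Hence [set0] is never a control. *)
Definition block_layer k : cnot_layer Q :=
  (target k (predC1 set0) predT, drop_var k).

(** The invariant: a set with a variable already processed is evaluated in all processed variables;
    a set whose first variable [k] is still ahead is evaluated through [k] in advance and stays so
    until its turn has passed. *)
Lemma run_block x z n : (n <= rd)%N ->
    (forall P, P :&: below k0.+1 != set0 -> z P = partial_eval k0.+1 x P) ->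
    (forall k P, (k0 < k < m)%N -> var k \in P -> P \subset from k ->
       z P = partial_eval k.+1 x P) ->
  (forall P, P :&: below (k0.+1 + n) != set0 ->
    run (map block_layer (iota k0.+1 n)) z P = partial_eval (k0.+1 + n) x P) /\
  (forall k P, (k0.+1 + n <= k < m)%N -> var k \in P -> P \subset from k ->
    run (map block_layer (iota k0.+1 n)) z P = partial_eval k.+1 x P).
Proof.
move=> le_n zlow zlead; elim: n le_n => [_|n IHn lt_n]; first by rewrite addn0; split.
have [IHlow IHlead] := IHn (ltnW lt_n); rewrite iotaSr map_rcons run_rcons addnS.
set K := (k0.+1 + n)%N in IHlow IHlead *.
have lt_Km : (K < m)%N by rewrite /K; lia.
split=> [P lowP|k P /andP[lt_k lt_km] kP sPk].
  rewrite ffunE /= /target /= andbT; have [P0|nP0] := eqVneq (P :&: below K) set0.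
    have sPK : P \subset from K by rewrite -below_set0 P0.
    have KP : var K \in P.
      move: lowP; apply: contraR => nKP; rewrite below_set0.
      apply/subsetP=> i iP; have := subsetP sPK _ iP; rewrite !inE leq_eqVlt.
      case/orP=> // eq_i; case/negP: nKP; suff <- : i = var K by [].
      by apply/eqP; rewrite var_val // eq_sym.
    by rewrite andbF addr0 (IHlead K) ?leqnn.
  rewrite andbT partial_evalS // IHlow //; case: ifP => // _.
  by rewrite IHlow // drop_var_below.
rewrite ffunE /= /target /= andbT.
have -> : (P :&: below K == set0) = true.
  by rewrite below_set0 (subset_trans sPk) // from_subset // ltnW.
by rewrite andbF addr0 (IHlead k) // lt_km ltnW.
Qed.

Theorem slots_correct (le_rd : (r <= rd)%N) x : low_degree x -> exists2 u, superposed u &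
  let y := run (map pruned_layer (iota 0 k0.+1)) x in
  let z := [ffun P => run (map chain_layer chain_seq) y (slot P)] in
  forall P, P != set0 ->
    run (map block_layer (iota k0.+1 rd)) z P = \sum_(A : Q | A \subset P) (x + u) A.
Proof.
move=> low_x; have [u sup_u eq_u] := run_pruned le_rd (leqnn k0.+1) low_x.
exists u => //; rewrite eq_u; set x' := x + u.
have low_x' : low_degree x' by apply: low_degreeD => //; apply: superposed_low sup_u.
move=> y z P nP0; have yE R : y R = _ := run_full_last x' R.
have y_from (R : Q) : R \subset from k0 -> y R = x' R.
  by move=> sR; rewrite yE below_set0 sR partial_eval_from.
have y0 : y (from k0) = 0.
  rewrite y_from // low_x' // card_from ?(ltnW lt_k0m) //.
  by rewrite -addnS addKn.
have zlead k (R : Q) : (k0 <= k < m)%N -> var k \in R -> R \subset from k ->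
    z R = partial_eval k.+1 x' R.
  move=> ok_k kR sRk; have /andP[le_k lt_km] := ok_k.
  have nR0 : R != set0 by apply: contraTneq kR => ->; rewrite inE.
  have sdRk : drop_var k R \subset from k.
    by apply: subset_trans sRk; apply: subsetDl.
  rewrite partial_evalS // kR !partial_eval_from //.
  have sk := from_subset le_k.
  rewrite -!y_from ?(subset_trans sRk) ?(subset_trans sdRk) // ffunE.
  case: slotP => [R0|j ok_j eq_R|_ nR]; first by rewrite R0 eqxx in nR0.
    have eq_jk : j = k by apply: lead_from; rewrite -?eq_R.
    by rewrite run_chain_from // eq_R eq_jk drop_var_fromE // addrC.
  by rewrite (run_chain_lead _ ok_k) // nR.
rewrite -partial_eval_all.
have [||k R /andP[lt_k lt_km]|run_z _] := @run_block x' z rd => //.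
- move=> R; have [R0|nR0] := eqVneq (R :&: below k0) set0.
    have sR : R \subset from k0 by rewrite -below_set0 R0.
    move=> lowR; apply: zlead => //; first by rewrite leqnn lt_k0m.
    apply: contraR lowR => nkR; rewrite below_set0; apply/subsetP=> i iR.
    have := subsetP sR _ iR; rewrite !inE leq_eqVlt eq_sym.
    rewrite -var_val ?lt_k0m // => /orP[/eqP eq_i|//].
    by rewrite -eq_i iR in nkR.
  move=> _; rewrite ffunE; case: slotP => [R0|k /andP[le_k _] eq_R|_ _].
  - by rewrite R0 set0I eqxx in nR0.
  - by rewrite eq_R from_below // eqxx in nR0.
  by rewrite run_chain_low // yE (negPf nR0).
- by apply: zlead; rewrite lt_km ltnW.
apply: run_z; rewrite below_set0; apply: contra nP0 => sP.
have /eqP from_m : from m == set0 by rewrite from_eq0.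
by rewrite -subset0 -from_m.
Qed.

(** * Gate counts *)

Lemma card_below k : (k <= m)%N -> #|below k| = k.
Proof.
move=> le_km; have -> : below k = ~: from k.
  by apply/setP=> i; rewrite !inE ltnNge.
by rewrite cardsCs setCK card_from // card_ord subKn.
Qed.

(** A target is determined by its parts before and after [var k], which are chosen independently. *)
Lemma card_target k (phi psi : pred Q) : (k < m)%N -> #|target k phi psi| =
  (#|[set a : Q | (a \subset below k) && phi a]| *
   #|[set b : Q | (b \subset from k.+1) && psi b]|)%N.
Proof.
move=> lt_km; rewrite -cardsX.
set X := setX _ _; pose F (w : Q * Q) := var k |: (w.1 :|: w.2).
have FK w : w \in X -> F w :&: below k = w.1 /\ F w :&: from k.+1 = w.2.
  case: w => a b; rewrite !inE /= => /andP[/andP[/subsetP sa _] /andP[/subsetP sb _]].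
  split; apply/setP=> i; rewrite !inE var_val //.
    have := sa i; have := sb i; rewrite !inE.
    by case: (i \in a) => [_ /(_ isT) ->|]; [rewrite orbT | case: (i \in b) => [/(_ isT)|_ _]; lia].
  have := sa i; have := sb i; rewrite !inE.
  by case: (i \in b) => [/(_ isT) -> _|_]; [rewrite !orbT | case: (i \in a) => [/(_ isT)|_]; lia].
rewrite -(@card_in_imset _ _ F X); last first.
  move=> [a b] [a' b'] /FK[/= a1 b1] /FK[/= a2 b2] eqF.
  by congr (_, _); [rewrite -a1 eqF a2 | rewrite -b1 eqF b2].
apply: eq_card => P; rewrite -[LHS]/(target k phi psi P); apply/idP/imsetP => [|[w Xw ->]].
  case/and3P=> kP phiP psiP; exists (P :&: below k, P :&: from k.+1).
    by rewrite !inE /= !subsetIr phiP.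
  apply/setP=> i; rewrite !inE var_val //; case: (ltngtP k i) => [_|_|eq_ki] /=.
  - by rewrite andbF andbT.
  - by rewrite andbF orbF andbT.
  by have -> : i = var k by apply/eqP; rewrite var_val // eq_ki.
have [F1 F2] := FK w Xw; rewrite /target F1 F2 !inE eqxx /=.
by move: Xw; rewrite !inE => /andP[/andP[_ ->] /andP[_ ->]].
Qed.

Lemma card_subsets_true (B : Q) :
  #|[set a : Q | (a \subset B) && true]| = (2 ^ #|B|)%N.
Proof. by rewrite -card_powerset; apply: eq_card => a; rewrite !inE andbT. Qed.

Lemma card_subsets_neq (B b : Q) : b \subset B ->
  #|[set a : Q | (a \subset B) && (a != b)]| = (2 ^ #|B|).-1.
Proof.
move=> sbB; rewrite -card_powerset (cardsD1 b (powerset B)) inE sbB /=.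
by apply: eq_card => a; rewrite !inE andbC.
Qed.

Lemma card_subsets_set0 (B : Q) :
  #|[set a : Q | (a \subset B) && (a == set0)]| = 1%N.
Proof.
rewrite -(cards1 (set0 : Q)); apply: eq_card => a; rewrite !inE.
by case: eqP => [->|]; rewrite ?sub0set ?andbF.
Qed.

Definition binom_sum lo n := (\sum_(lo <= j < rd.+1) 'C(n, j))%N.

Lemma card_subsets_between (T : finType) (B : {set T}) lo :
  #|[set a : {set T} | (a \subset B) && (lo <= #|a| <= rd)%N]| =
  binom_sum lo #|B|.
Proof.
rewrite /binom_sum; under eq_bigr => j _ do rewrite -cards_draws -sum1_card.
rewrite (exchange_big_dep (fun a : {set T} => a \subset B)) /=; last first.
  by move=> j a _; rewrite inE => /andP[].
rewrite -sum1_card big_mkcond [RHS]big_mkcond; apply: eq_bigr => a _.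
rewrite inE; case: (boolP (a \subset B)) => //= sa.
rewrite (eq_bigl (fun j => j == #|a|)) => [|j]; last by rewrite inE sa eq_sym.
by rewrite big_nat1_eq ltnS.
Qed.

Lemma card_pruned k : (k < k0)%N ->
  #|(pruned_layer k).1| = (2 ^ k * binom_sum (r - k) (rd + k0 - k))%N.
Proof.
move=> lt_k; have lt_km : (k < m)%N by lia.
rewrite card_target // card_subsets_between card_from // lt_k.
by rewrite card_subsets_true card_below ?(ltnW lt_km) // subSS addnC.
Qed.

Lemma card_pruned_last :
  #|(pruned_layer k0).1| = ((2 ^ k0).-1 * binom_sum (r - k0) rd)%N.
Proof.
rewrite card_target ?lt_k0m // card_subsets_between card_from ?lt_k0m // ltnn.
by rewrite card_subsets_neq ?sub0set // card_below ?(ltnW lt_k0m) // subSS addKn.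
Qed.

Lemma card_split k : (k < m)%N -> #|(split_layer k).1| = (2 ^ (m - k.+1)).-1.
Proof.
move=> lt_km; rewrite card_target // card_subsets_set0 mul1n.
by rewrite card_subsets_neq // card_from.
Qed.

Lemma card_shift k : #|(shift_layer k).1| = 1%N.
Proof. exact: card1. Qed.

Lemma card_block k : (k < m)%N ->
  #|(block_layer k).1| = ((2 ^ k).-1 * 2 ^ (m - k.+1))%N.
Proof.
move=> lt_km; rewrite card_target // card_subsets_true card_from //.
by rewrite card_subsets_neq ?sub0set // card_below // ltnW.
Qed.

(** The vacant slot is not a target because its block is skipped at [k0], and not a control because
    its [rd + 1] variables would exceed the upper bound [rd]. *)
Lemma pruned_layer_ok k : (k <= k0)%N -> layer_ok (from k0) (pruned_layer k).
Proof.
move=> le_k; have lt_km : (k < m)%N := leq_ltn_trans le_k lt_k0m.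
apply: target_layer_ok => P /and3P[kP lowP /andP[_ hiP]]; split.
  apply: contraTneq lowP => eq_P; move: kP; rewrite eq_P mem_var_from // => le_k0.
  by rewrite ltnNge le_k0 /= from_below // eqxx.
apply/eqP=> eq_P; have := var_drop_var k P; rewrite eq_P mem_var_from // leqNgt.
move/negbT; rewrite negbK => lt_k; move: hiP; rewrite -drop_var_from // eq_P.
rewrite (setIidPl (from_subset lt_k)) card_from ?(ltnW lt_k0m) //.
by rewrite -addnS addKn ltnn.
Qed.

Lemma split_layer_ok k : (k0 <= k < m)%N -> layer_ok (from k0) (split_layer k).
Proof.
move=> /andP[le_k lt_km]; apply: target_layer_ok => P tP; split.
  by apply: contraTneq tP => ->; have := split_layer_from k0 lt_km => /= ->.
apply/eqP=> eq_P; have := var_drop_var k P.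
by rewrite eq_P mem_var_from // le_k.
Qed.

Lemma shift_layer_ok k : (k0 < k < m)%N -> layer_ok (from k0) (shift_layer k).
Proof.
move=> /andP[lt_k lt_km] P /= /eqP ->; rewrite !(inj_in_eq from_inj) ?inE ?(ltnW lt_k0m) ?(ltnW lt_km) //.
split; try lia.
by move=> P' /eqP.
Qed.

Lemma block_layer_ok k : (k < m)%N -> layer_ok set0 (block_layer k).
Proof.
move=> lt_km; apply: target_layer_ok => P /and3P[kP nP0 _]; split.
  by apply: contraTneq kP => ->; rewrite inE.
apply: contraNneq nP0 => eq_P; apply/eqP.
by rewrite -drop_var_below // eq_P set0I.
Qed.

End Slots.

(** * Closed forms of the zeta recursions *)

Fixpoint butterfly_count rd k r :=
  if k is k'.+1 then (binom_sum rd r (rd + k') + 2 * butterfly_count rd k' r.-1)%N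
  else 0%N.

(** The last layer is kept apart because the punctured block takes no part in it: the circuit has
    [(2 ^ k).-1] there instead of [2 ^ k]. *)
Lemma butterfly_countE rd k r : butterfly_count rd k.+1 r =
  (\sum_(0 <= i < k) 2 ^ i * binom_sum rd (r - i) (rd + k - i)
     + 2 ^ k * binom_sum rd (r - k) rd)%N.
Proof.
elim: k r => [|k IHk] r; first by rewrite big_nil /= addn0 subn0 mul1n muln0 addn0.
rewrite [LHS]/= -/(butterfly_count rd k.+1 r.-1) IHk mulnDr mulnA -expnS addnA.
rewrite -subn1 -subnDA add1n; congr (_ + _)%N.
rewrite big_nat_recl // mul1n !subn0 big_distrr /=; congr (_ + _)%N.
apply: eq_bigr => i _; rewrite mulnA -expnS; congr (_ * binom_sum _ _ _)%N; lia.
Qed.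

Lemma zeta_cE s d :
  zeta_c s (s + d) = (butterfly_count s d 0 + 2 ^ d * (s * 2 ^ s.-1))%N.
Proof.
elim: d => [|d IHd].
  by rewrite addn0 mul1n add0n; case: s => [|s]; rewrite /= ?eqxx.
rewrite addnS /= ifN ?IHd; last by lia.
by rewrite /binom_sum expnS mulnDr -!mulnA addnA.
Qed.

Lemma half_pow s : (2 * (s * 2 ^ s.-1) = s * 2 ^ s)%N.
Proof. by case: s => // s; rewrite expnS mulnCA. Qed.

(** This agrees with the circuit at [k0 = 0]: [2 ^ s.+1 - 2] tree edges and [s * 2 ^ s - 2 ^ s + 1]
    block gates. *)
Lemma zeta_starE s : ((zeta_star s).+1 = s.+1 * 2 ^ s)%N.
Proof.
elim: s => // s IHs.
have -> : zeta_star s.+1 = (2 ^ s.+1 + zeta_star s + zeta_c s s.+1)%N by [].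
rewrite -[X in zeta_c _ X]addn1 zeta_cE.
have -> : butterfly_count s 1 0 = (2 ^ s)%N.
  rewrite /= muln0 addn0 addn0 /binom_sum big_mkord.
  rewrite -[2%N]/(1 + 1)%N expnDn; apply: eq_bigr => i _.
  by rewrite !exp1n !muln1.
rewrite half_pow expnS; nia.
Qed.

Lemma zeta_star_cE s d :
  (zeta_star_c s (s.+1 + d) + binom_sum s (0 - d) s + 1 =
   butterfly_count s d.+1 0 + 2 ^ s + s * 2 ^ (d + s))%N.
Proof.
elim: d => [|d IHd].
  rewrite addn0 [zeta_star_c _ _]/= eqxx /= addn0 add0n subn0.
  by have := zeta_starE s; rewrite mulSn; lia.
have -> : zeta_star_c s (s.+1 + d.+1) =
    (binom_sum s 0 (s + d.+1) + zeta_star_c s (s.+1 + d) + zeta_c s (s + d.+1))%N.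
  have zE t : zeta_star_c s t.+1 = if t.+1 == s.+1 then zeta_star s else
    (\sum_(0 <= j < s.+1) 'C(t, j) + zeta_star_c s t + zeta_c s t)%N by [].
  by rewrite addnS zE ifN ?addSnnS //; lia.
rewrite zeta_cE.
rewrite [butterfly_count s d.+2 0]/= -/(butterfly_count s d.+1 0).
move: IHd; rewrite !sub0n.
have -> : (2 ^ d.+1 * (s * 2 ^ s.-1) = s * 2 ^ (d + s))%N.
  by rewrite expnSr -mulnA half_pow mulnCA -expnD.
have -> : (s * 2 ^ (d.+1 + s) = 2 * (s * 2 ^ (d + s)))%N by rewrite addSn expnS mulnCA.
lia.
Qed.

Section ZetaClosedForms.
Variables (rd md : nat).

Lemma int_sumE (r m' : nat) :
  (\sum_(0 <= j < rd.+1 | (r%:Z <= j%:Z)%R) 'C(m', j) = binom_sum rd r m')%N.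
Proof.
by rewrite /binom_sum (big_nat_widenl r 0).
Qed.

(** The hypothesis is the invariant of the recursion, that the second argument minus the first is
    [md - rd]. It turns the two stopping tests into [r = 0] and [k = 0]. *)
Lemma zeta_0E k r : (md + r = rd + k.+1 + rd)%N ->
  zeta_0 rd md (r%:Z - 1) (rd + k) =
    (butterfly_count rd k r.-1 + 2 ^ k * (rd * 2 ^ rd.-1))%N.
Proof.
have zE (t : int) m' : zeta_0 rd md t m'.+1 =
    if (2 * rd + 1 <= md)%N && (t == -1) then zeta_c rd m'.+1 else
    if (md < 2 * rd + 1)%N && (m'.+1 == rd) then zeta_c rd rd else
    (\sum_(0 <= j < rd.+1 | (t <= j%:Z)%R) 'C(m', j)
       + 2 * zeta_0 rd md (t - 1)%R m')%N by [].
have z1 t m' : (2 * rd + 1 <= md)%N -> t = -1 -> zeta_0 rd md t m' = zeta_c rd m'.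
  by move=> le_md ->; case: m' => [|m'] /=; rewrite le_md eqxx.
have z2 t m' : (md < 2 * rd + 1)%N -> m' = rd -> zeta_0 rd md t m' = zeta_c rd rd.
  by move=> lt_md; case: m' => [|m'] /eqP eq_m /=; rewrite leqNgt lt_md /= eq_m.
elim: k r => [|k IHk] [|r] eq_md.
- rewrite z1 //; last by lia.
  by rewrite zeta_cE.
- rewrite z2 ?addn0 //; last by lia.
  by rewrite -[X in zeta_c rd X]addn0 zeta_cE.
- by rewrite z1 ?zeta_cE //; lia.
rewrite addnS zE ifN; last by lia.
rewrite ifN; last by lia.
have -> : r.+1%:Z - 1 = r%:Z by rewrite -addn1 PoszD addrK.
rewrite int_sumE IHk; last by lia.
by rewrite [in RHS]/= expnS mulnDr -!mulnA addnA.
Qed.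

(** Without puncturing the count would be [butterfly_count rd k.+1 r + rd * 2 ^ (k + rd)]. In one
    block of [rd + 1] variables, [binom_sum rd (r - k) rd + rd * 2 ^ rd] gates are replaced by
    [zeta_star rd]; the terms moved to the left avoid truncated subtraction. *)
Lemma zeta_star_0E k r : (md + r = rd + k.+1 + rd)%N ->
  (zeta_star_0 rd md r%:Z (rd + k).+1 + binom_sum rd (r - k) rd + 1 =
    butterfly_count rd k.+1 r + 2 ^ rd + rd * 2 ^ (k + rd))%N.
Proof.
have zE (t : int) m' : zeta_star_0 rd md t m'.+1 =
    if (2 * rd + 1 <= md)%N && (t == 0) then zeta_star_c rd m'.+1 else
    if (md < 2 * rd + 1)%N && (t == 2 * rd%:Z - md%:Z + 1) then zeta_star rd else
    (\sum_(0 <= j < rd.+1 | (t <= j%:Z)%R) 'C(m', j)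
       + zeta_star_0 rd md (t - 1)%R m' + zeta_0 rd md (t - 1)%R m')%N by [].
elim: k r => [|k IHk] [|r] eq_md.
- rewrite zE ifT; last by lia.
  by rewrite -[(rd + _).+1]addSn zeta_star_cE.
- rewrite zE ifN; last by lia.
  rewrite ifT; last by lia.
  rewrite [butterfly_count _ _ _]/= addn0 add0n subn0.
  by have := zeta_starE rd; rewrite mulSn; lia.
- rewrite zE ifT; last by lia.
  by rewrite -[(rd + _).+1]addSn zeta_star_cE.
rewrite zE ifN; last by lia.
rewrite ifN; last by lia.
rewrite int_sumE zeta_0E; last by lia.
have -> : r.+1%:Z - 1 = r%:Z by rewrite -addn1 PoszD addrK.
have /IHk : (md + r = rd + k.+1 + rd)%N by lia.
rewrite succnK -addnS -/(butterfly_count rd k.+1 r).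
have -> : (2 ^ k.+1 * (rd * 2 ^ rd.-1) = rd * 2 ^ (k + rd))%N.
  by rewrite expnSr -mulnA half_pow mulnCA -expnD.
have -> : (rd * 2 ^ (k.+1 + rd) = 2 * (rd * 2 ^ (k + rd)))%N.
  by rewrite addSn expnS mulnCA.
have -> : butterfly_count rd k.+2 r.+1 =
  (binom_sum rd r.+1 (rd + k.+1) + 2 * butterfly_count rd k.+1 r)%N by [].
rewrite subSS; lia.
Qed.

End ZetaClosedForms.

(** * Gate count of the constructed circuit *)

Section CircuitSize.
Variables k0 rd : nat.

Lemma sum_pow_pred n :
  (\sum_(0 <= i < n.+1) (2 ^ (n - i)).-1 + n.+2 = 2 ^ n.+1)%N.
Proof.
elim: n => [|n IHn]; first by rewrite big_nat1.
rewrite big_nat_recl // subn0 [(2 ^ n.+2)%N]expnS.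
have -> : (\sum_(0 <= i < n.+1) (2 ^ (n.+1 - i.+1)).-1 =
           \sum_(0 <= i < n.+1) (2 ^ (n - i)).-1)%N.
  by apply: eq_bigr => i _; rewrite subSS.
have : (0 < 2 ^ n.+1)%N by rewrite expn_gt0.
lia.
Qed.

Lemma sum_block n :
  (\sum_(0 <= i < n) (2 ^ (k0.+1 + i)).-1 * 2 ^ (n - i.+1) + 2 ^ n =
   n * 2 ^ (k0 + n) + 1)%N.
Proof.
elim: n => [|n IHn]; first by rewrite big_nil.
rewrite big_nat_recr //= subnn muln1.
have -> : (\sum_(0 <= i < n) (2 ^ (k0.+1 + i)).-1 * 2 ^ (n.+1 - i.+1) =
   2 * \sum_(0 <= i < n) (2 ^ (k0.+1 + i)).-1 * 2 ^ (n - i.+1))%N.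
  rewrite big_distrr; apply: eq_big_nat => i /andP[_ lt_in] /=.
  by rewrite subSn // expnS mulnCA.
have : (0 < 2 ^ (k0.+1 + n))%N by rewrite expn_gt0.
have -> : (2 ^ (k0.+1 + n) = 2 * 2 ^ (k0 + n))%N by rewrite addSn expnS.
have -> : (n.+1 * 2 ^ (k0 + n.+1) = 2 * (2 ^ (k0 + n) + n * 2 ^ (k0 + n)))%N.
  by rewrite addnS expnS mulnCA mulSn.
rewrite [(2 ^ n.+1)%N]expnS; lia.
Qed.

Lemma total_count r :
  (\sum_(k <- iota 0 k0.+1) #|(pruned_layer k0 rd r k).1| +
   (\sum_(b <- chain_seq k0 rd) #|(chain_layer k0 rd b).1| +
    \sum_(k <- iota k0.+1 rd) #|(block_layer k0 rd k).1|) +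
   binom_sum rd (r - k0) rd + 1 =
   butterfly_count rd k0.+1 r + 2 ^ rd + rd * 2 ^ (k0 + rd))%N.
Proof.
have sum_iota a n (F : nat -> nat) :
    (\sum_(k <- iota a n) F k = \sum_(0 <= i < n) F (a + i))%N.
  by rewrite -[in LHS](addn0 a) iotaDl big_map /index_iota subn0.
have -> : (\sum_(k <- iota 0 k0.+1) #|(pruned_layer k0 rd r k).1| =
     \sum_(0 <= i < k0) 2 ^ i * binom_sum rd (r - i) (rd + k0 - i)
       + (2 ^ k0).-1 * binom_sum rd (r - k0) rd)%N.
  rewrite sum_iota big_nat_recr // -card_pruned_last -[LHS]/(_ + _)%N; congr addn.
  by apply: eq_big_nat => i /andP[_ lt_i]; rewrite card_pruned.
have -> : (\sum_(b <- chain_seq k0 rd) #|(chain_layer k0 rd b).1| =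
     \sum_(0 <= i < rd.+1) (2 ^ (rd - i)).-1 + rd)%N.
  rewrite big_cat !big_map; congr (_ + _)%N.
    rewrite sum_iota; apply: eq_big_nat => i /andP[_ lt_i].
    have lt_m : (k0 + i < (k0 + rd).+1)%N by rewrite ltnS leq_add2l.
    by rewrite [LHS](card_split lt_m) subSS subnDl.
  rewrite (eq_bigr (fun=> 1%N)) => [|k _]; last exact: (@card_shift k0 rd).
  by rewrite big_const_seq count_predT size_rev size_iota iter_addn_0 mul1n.
have -> : (\sum_(k <- iota k0.+1 rd) #|(block_layer k0 rd k).1| =
    \sum_(0 <= i < rd) (2 ^ (k0.+1 + i)).-1 * 2 ^ (rd - i.+1))%N.
  rewrite sum_iota; apply: eq_big_nat => i /andP[_ lt_i].
  have lt_m : (k0.+1 + i < (k0 + rd).+1)%N by rewrite addSn ltnS ltn_add2l.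
  by rewrite card_block // addSn -addnS subSS subnDl.
have := sum_pow_pred rd; have := sum_block rd.
rewrite butterfly_countE expnS.
have : (0 < 2 ^ k0)%N by rewrite expn_gt0.
case: (2 ^ k0)%N => // a _; rewrite mulSn.
lia.
Qed.

End CircuitSize.

(** * Monomials and evaluation points *)

Section Points.
Variable m : nat.

Definition point (j : 'I_(2 ^ m)) : {set 'I_m} := [set i | bits j i != 0].

Lemma natr_F2 x : x%:R = (odd x)%:R :> 'F_2.
Proof.
rewrite -[in LHS](odd_double_half x) natrD -muln2 natrM.
have -> : 2%:R = 0 :> 'F_2 by apply: val_inj.
by rewrite mulr0 addr0.
Qed.

Lemma bitsE (j : 'I_(2 ^ m)) i : bits j i = (i \in point j)%:R.
Proof. by rewrite inE; case: (F2_cases (bits j i)) => ->. Qed.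

Lemma point_inj : injective point.
Proof.
move=> j j' eq_jj'.
(* The numbers formed by the [d] leading bits agree, by induction on [d]. *)
have eq_div d : (d <= m)%N -> (j %/ 2 ^ (m - d) = j' %/ 2 ^ (m - d))%N.
  elim: d => [|d IHd lt_dm]; first by rewrite subn0 !divn_small.
  have eq_odd : odd (j %/ 2 ^ (m - d.+1)) = odd (j' %/ 2 ^ (m - d.+1)).
    have : bits j (Ordinal lt_dm) = bits j' (Ordinal lt_dm).
      by rewrite !bitsE eq_jj'.
    rewrite /bits /= natr_F2 [RHS]natr_F2.
    by do 2!case: (odd _).
  have halfE (x : nat) : (x %/ 2 ^ (m - d.+1))./2 = (x %/ 2 ^ (m - d))%N.
    by rewrite -divn2 -divnMA -expnSr -subSn // subSS.
  rewrite -[LHS]odd_double_half -[RHS]odd_double_half eq_odd !halfE.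
  by rewrite IHd // ltnW.
by apply: val_inj; have := eq_div m (leqnn m); rewrite subnn !divn1.
Qed.

Lemma point0 : point (Ordinal (pow2_gt0 m)) = set0.
Proof. by apply/setP=> i; rewrite !inE /bits /= div0n eqxx. Qed.

Definition ppoint (j : 'I_(2 ^ m).-1) := point (lift (Ordinal (pow2_gt0 m)) j).

Lemma ppoint_inj : injective ppoint.
Proof. by move=> j j' /point_inj/lift_inj. Qed.

Lemma ppoint_neq0 j : ppoint j != set0.
Proof. by rewrite -point0 (inj_eq point_inj) eq_sym neq_lift. Qed.

Definition pmono (A : {set 'I_m}) := puncture (Eval 'X_[mesym1 A]).

Lemma pmonoE A j : pmono A 0 j = (A \subset ppoint j)%:R.
Proof.
rewrite !mxE mevalX (bigID (fun i => i \in A)) /=.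
rewrite [X in _ * X]big1 ?mulr1 => [|i /negPf nA]; last by rewrite mnmE nA expr0.
case: (boolP (A \subset ppoint j)) => [/subsetP sA|/subsetPn[i iA /negPf i_notin]].
  by rewrite big1 // => i iA; rewrite mnmE iA expr1 bitsE sA.
by rewrite (bigD1 i) //= mnmE iA expr1 bitsE i_notin mul0r.
Qed.

Lemma pmono_set0 : pmono set0 = const_mx 1.
Proof. by apply/rowP=> j; rewrite pmonoE sub0set mxE. Qed.

End Points.

(** By counting, [f] misses [T] only. The value [g T] is a default, which is where [0 < n]
    enters. *)
Lemma partial_inverse (Q : finType) n (T : Q) (f : 'I_n -> Q) :
    (0 < n)%N -> #|Q| = n.+1 -> injective f -> (forall j, f j != T) ->
  exists2 g, cancel f g & forall P, P != T -> f (g P) = P.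
Proof.
case: n f => // n f _ cardQ f_inj nT.
have codom_f : codom f =i predC1 T.
  apply/subset_cardP; last first.
    by apply/subsetP=> _ /codomP[j ->]; rewrite inE nT.
  by rewrite card_codom // card_ord cardC1 cardQ.
pose g P := odflt ord0 [pick j | f j == P].
have gK P : P != T -> f (g P) = P.
  move=> nTP; have /codomP[j eq_P] : P \in codom f by rewrite codom_f inE.
  by rewrite /g; case: pickP => [k /eqP//|/(_ j)]; rewrite eq_P eqxx.
by exists g => // j; apply: f_inj; rewrite gK.
Qed.

(** * The CNOT circuit on the qubits *)

Section CnotEncoder.
Variables k0 rd r : nat.
Hypothesis le_rd : (r <= rd)%N.
Local Notation m := (k0 + rd).+1.
Local Notation n := (2 ^ m).-1.

(** The qubits are labelled by [f] up to the chain layers and by [ppoint] afterwards; [slot] is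
    absorbed in this change of labels. *)
Theorem cnot_encoder : exists (f : 'I_n -> {set 'I_m}) (c : circuit n),
  [/\ injective f /\ (forall A : {set 'I_m}, (#|A| <= rd)%N -> exists j, f j = A),
      circuit_wf c /\ Hadamard_free c,
      depth c = (k0 + 3 * rd + 2)%N,
      (CNOT_count c + binom_sum rd (r - k0) rd + 1 =
       butterfly_count rd k0.+1 r + 2 ^ rd + rd * 2 ^ (k0 + rd))%N &
      forall x : 'rV['F_2]_n, (forall j, (rd < #|f j|)%N -> x 0 j = 0) ->
        exists2 u : 'rV['F_2]_n, supp_in [pred j | (0 < #|f j| <= r)%N] u &
          circuit_act c x = \sum_j (x + u) 0 j *: pmono (f j)].
Proof.
have n_gt0 : (0 < n)%N by rewrite -subn1 subn_gt0 -[1%N]/(2 ^ 0)%N ltn_exp2l.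
have cardQ : #|{set 'I_m}| = n.+1.
  by rewrite -cardsT -powersetT card_powerset cardsT card_ord prednK ?expn_gt0.
pose T := @from k0 rd k0.
have cardT : #|T| = rd.+1 by rewrite card_from ?(ltnW (lt_k0m _ _)) // -addnS addKn.
pose f j := slot (@ppoint m j).
have f_inj : injective f by move=> j j' /slot_inj/ppoint_inj.
have f_nT j : f j != T by apply/slot_neq/ppoint_neq0.
have [g fK gK] := partial_inverse n_gt0 cardQ f_inj f_nT.
have [h ppK hK] := partial_inverse n_gt0 cardQ (@ppoint_inj m) (@ppoint_neq0 m).
have [|c1 [wf1 free1 d1 n1 act1]] := @layers_circuit _ _ T f g fK gK _
    (@pruned_layer k0 rd r) (iota 0 k0.+1).
  by move=> k; rewrite mem_iota => /andP[_ lt_k]; apply: pruned_layer_ok.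
have [|c2 [wf2 free2 d2 n2 act2]] := @layers_circuit _ _ T f g fK gK _
    (@chain_layer k0 rd) (chain_seq k0 rd).
  move=> b; rewrite mem_cat => /orP[] /mapP[k + ->].
    by rewrite mem_chain_iota; apply: split_layer_ok.
  by rewrite mem_rev mem_shift_iota; apply: shift_layer_ok.
have [|c3 [wf3 free3 d3 n3 act3]] := @layers_circuit _ _ set0 _ h ppK hK _
    (@block_layer k0 rd) (iota k0.+1 rd).
  by move=> k; rewrite mem_shift_iota => /andP[_ lt_k]; apply: block_layer_ok.
exists f, (c1 ++ (c2 ++ c3)); split.
- split=> // A leA; exists (g A); apply: gK.
  by apply: contraTneq leA => ->; rewrite cardT ltnn.
- move: wf1 wf2 wf3 free1 free2 free3; rewrite /circuit_wf /Hadamard_free.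
  by rewrite !all_cat => -> -> -> -> -> ->.
- move: d1 d2 d3; rewrite /depth !count_cat => -> -> ->.
  by rewrite /chain_seq size_cat !size_map size_rev !size_iota; lia.
- move: n1 n2 n3; rewrite /CNOT_count !map_cat !sumn_cat => -> -> ->.
  exact: total_count.
move=> x low_x; pose X := [ffun A => if A == T then 0 else x 0 (g A)].
have readX : read f X = x.
  by apply/rowP=> j; rewrite mxE ffunE (negPf (f_nT j)) fK.
have [|u sup_u actX] := @slots_correct k0 rd r le_rd X.
  move=> A hiA; rewrite ffunE; case: eqP => // /eqP nTA.
  by rewrite low_x // gK.
exists (read f u).
  by apply/supp_inP=> j nj; rewrite mxE sup_u.
rewrite /circuit_act !foldl_cat -/(circuit_act c1 x) -readX act1.
rewrite -/(circuit_act c2 _) act2.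
set w := run (map (chain_layer _ _) _) _ in actX *.
have -> : read f w = read (@ppoint m) [ffun P => w (slot P)].
  by apply/rowP=> j; rewrite !mxE ffunE.
rewrite -/(circuit_act c3 _) act3; apply/rowP=> j.
rewrite mxE actX ?ppoint_neq0 // summxE.
have XuT : (X + u) T = 0.
  rewrite !ffunE eqxx add0r sup_u // cardT; lia.
rewrite big_mkcond (bigD1 T) //= XuT if_same add0r.
rewrite (reindex_onto f g) /=; last by move=> A /gK.
apply: eq_big => [i|i _]; first by rewrite f_nT fK eqxx.
rewrite [RHS]mxE pmonoE -/(ppoint j) !mxE !ffunE.
by case: (_ \subset _); rewrite ?mulr1 ?mulr0.
Qed.

End CnotEncoder.

(** * The quantum encoder *)

Section Superposition.
Variable n : nat.
Implicit Types (P : pred 'I_n) (u v : 'rV['F_2]_n).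

Lemma supp_inD P u v : supp_in P u -> supp_in P v -> supp_in P (u + v).
Proof.
move=> /supp_inP su /supp_inP sv; apply/supp_inP=> j nPj.
by rewrite mxE su // sv // addr0.
Qed.

Lemma supp_in_delta P a j : P j -> supp_in P (a *: delta_mx 0 j).
Proof.
move=> Pj; apply/supp_inP=> i nPi; rewrite !mxE.
by case: (eqVneq i j) nPi => [->|_ _]; rewrite ?Pj // andbF mulr0.
Qed.

Lemma card_supp_in P : #|[set u | supp_in P u]| = (2 ^ #|P|)%N.
Proof.
pose chi (A : {set 'I_n}) : 'rV['F_2]_n := \row_j (j \in A)%:R.
have chi_inj : injective chi.
  move=> A B /rowP eqAB; apply/setP=> j; have := eqAB j; rewrite !mxE.
  by do 2!case: (j \in _).
have <- : #|[set j | P j]| = #|P| by apply: eq_card => j; rewrite inE.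
rewrite -card_powerset -(card_imset _ chi_inj).
apply: eq_card => u; rewrite inE; apply/supp_inP/imsetP => [su|[A]].
  exists [set j | u 0 j != 0].
    rewrite inE; apply/subsetP=> j; rewrite !inE; apply: contraR => nPj.
    by rewrite su.
  by apply/rowP=> j; rewrite !mxE inE; case: (F2_cases (u 0 j)) => ->.
rewrite inE => /subsetP sAP -> j nPj; rewrite mxE.
by case: (boolP (j \in A)) => // /sAP; rewrite inE => Pj; rewrite Pj in nPj.
Qed.

Lemma supp_in_span P (F : 'I_n -> 'rV['F_2]_n) (s : seq 'rV['F_2]_n) v :
    (forall w, w \in s -> exists2 j, P j & F j = w) -> v \in <<s>>%VS ->
  exists2 u, supp_in P u & \sum_j u 0 j *: F j = v.
Proof.
elim: s v => [|w s IHs] v sF.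
  rewrite span_nil memv0 => /eqP ->; exists 0.
    by apply/supp_inP=> j _; rewrite mxE.
  by rewrite big1 // => j _; rewrite mxE scale0r.
rewrite span_cons => /memv_addP[_ /vlineP[a ->] [v' /IHs IHv ->]].
have [j Pj Fj] := sF w (mem_head _ _).
have [w' w'_in|u su <-] := IHv; first by apply: sF; rewrite inE w'_in orbT.
exists (a *: delta_mx 0 j + u); first by rewrite supp_inD // supp_in_delta.
under eq_bigr => i _ do rewrite mxE scalerDl.
rewrite big_split /= (bigD1 j) //= big1 => [|i /negPf neq_ij].
  by rewrite !mxE !eqxx mulr1 addr0 Fj.
by rewrite !mxE neq_ij andbF mulr0 scale0r.
Qed.

End Superposition.

Lemma pmonomialsE m a b :
  pmonomials m a b = [seq pmono A | A <- enum [set A : {set 'I_m} | a <= #|A| <= b]%N].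
Proof.
congr map; apply: eq_enum => A; rewrite !inE.
by rewrite mdeg_mesym1.
Qed.

Section Encoder.
Variables (C : numClosedFieldType) (k0 rd r : nat).
Hypothesis le_rd : (r <= rd)%N.
Local Notation m := (k0 + rd).+1.
Local Notation n := (2 ^ m).-1.
Local Notation k := (num_logical r m rd).

Definition G1_monomials : seq {set 'I_m} :=
  set0 :: enum [set A : {set 'I_m} | r < #|A| <= rd]%N.

Lemma size_G1_monomials : size G1_monomials = k.
Proof.
rewrite /= -cardE /num_logical add1n; congr _.+1.
have := card_subsets_between rd [set: 'I_m] r.+1; rewrite /binom_sum cardsT card_ord => <-.
by apply: eq_card => A; rewrite !inE subsetT.
Qed.

Lemma uniq_G1_monomials : uniq G1_monomials.
Proof. by rewrite /= enum_uniq andbT mem_enum inE cards0. Qed.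

Definition G1 : 'M['F_2]_(k, n) :=
  \matrix_(i, j) pmono (nth set0 G1_monomials i) 0 j.

Lemma row_G1 i : row i G1 = pmono (nth set0 G1_monomials i).
Proof. by apply/rowP=> j; rewrite !mxE. Qed.

Lemma G1P : is_G1 G1.
Proof.
rewrite /is_G1 pmonomialsE -pmono_set0.
rewrite -[X in perm_eq _ X]/(map (@pmono m) G1_monomials).
rewrite (eq_map (row_G1)) map_comp.
have -> : [seq nth set0 G1_monomials (i : 'I_k) | i <- enum 'I_k] = G1_monomials.
  rewrite (map_comp (nth set0 G1_monomials) val) val_enum_ord -size_G1_monomials.
  exact: (mkseq_nth set0 G1_monomials).
exact: perm_refl.
Qed.

Theorem encoder_exists : exists c : circuit n,
  [/\ is_encoder r rd (circuit_mx C c), circuit_wf c,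
      depth c = (k0 + 3 * rd + 3)%N &
      (CNOT_count c + binom_sum rd (r - k0) rd + 1 =
       butterfly_count rd k0.+1 r + 2 ^ rd + rd * 2 ^ (k0 + rd))%N].
Proof.
have [f [c [[f_inj f_surj] [wf_c free_c] d_c n_c act_c]]] := cnot_encoder k0 le_rd.
pose H := [pred j : 'I_n | (0 < #|f j| <= r)%N].
pose M := G1_monomials.
(* Labels of the logical qubits come first, so that the initial relabeling sends the padded message
   to the qubits of its monomials. *)
pose s := M ++ [seq A <- map f (enum 'I_n) | A \notin M].
have sub_M A : A \in M -> A \in map f (enum 'I_n).
  move=> M_A; have [|j <-] := f_surj A; last by rewrite map_f ?mem_enum.
  by move: M_A; rewrite inE mem_enum inE => /predU1P[->|/andP[]//]; rewrite cards0.
have uniq_f : uniq (map f (enum 'I_n)) by rewrite map_inj_uniq ?enum_uniq.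
have perm_s : perm_eq s (map f (enum 'I_n)).
  apply: uniq_perm => //.
    rewrite cat_uniq uniq_G1_monomials filter_uniq // andbT.
    by apply/hasPn=> A; rewrite mem_filter => /andP[].
  move=> A; rewrite mem_cat mem_filter; case: (boolP (A \in M)) => //= M_A.
  by rewrite sub_M.
have size_s : size s = n by rewrite (perm_size perm_s) size_map size_enum_ord.
have idx_lt j : (index (f j) s < n)%N.
  by rewrite -size_s index_mem (perm_mem perm_s) map_f ?mem_enum.
pose idx j := Ordinal (idx_lt j).
have idx_inj : injective idx.
  move=> j j' eq_jj'; apply: f_inj.
  have eq_idx : index (f j) s = index (f j') s := congr1 val eq_jj'.
  have s_f i : f i \in s by rewrite (perm_mem perm_s) map_f ?mem_enum.
  by rewrite -(nth_index set0 (s_f j)) eq_idx nth_index.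
pose p := perm idx_inj.
have p_f j : f j = nth set0 s (p j).
  by rewrite permE nth_index // (perm_mem perm_s) map_f ?mem_enum.
have le_kn : (k <= n)%N by rewrite -size_s size_cat size_G1_monomials leq_addr.
have nth_s i : (i < k)%N -> nth set0 s i = nth set0 M i.
  by move=> lt_ik; rewrite nth_cat size_G1_monomials lt_ik.
pose hs := enum H.
exists (Relabel p :: Layer [seq Hadamard q | q <- hs] :: c); split; last first.
- rewrite /CNOT_count /= -/(CNOT_count c) -n_c; congr (_ + _ + _)%N.
  by rewrite count_map /= -size_filter filter_pred0.
- by rewrite /depth /= -/(depth c) d_c; lia.
- rewrite /= wf_c andbT; have -> : flatten (map (@gate_qubits n) (map (@Hadamard n) hs)) = hs.
    by elim: (hs) => //= q qs ->.
  exact: enum_uniq.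
exists G1; first exact: G1P.
move=> msg; set x := col_perm p (pad n msg).
have x_val j : x 0 j = pad n msg 0 (p j) by rewrite mxE.
have x0 j : f j \notin M -> x 0 j = 0.
  move=> nM; rewrite x_val mxE insubF //; apply/negbTE; apply: contra nM => lt_pk.
  by rewrite p_f nth_s // mem_nth // size_G1_monomials.
have x_H : {in hs, forall q, x 0 q = 0}.
  move=> q; rewrite mem_enum inE => /andP[q_gt0 q_le]; apply: x0.
  by rewrite inE mem_enum inE negb_or -cards_eq0 -lt0n q_gt0 ltnNge q_le.
have x_low j : (rd < #|f j|)%N -> x 0 j = 0.
  move=> hi_j; apply: x0; rewrite inE mem_enum inE negb_or -cards_eq0.
  by rewrite [(_ <= rd)%N]leqNgt hi_j andbF andbT -lt0n; apply: leq_trans hi_j.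
pose L (u : 'rV['F_2]_n) := \sum_j u 0 j *: pmono (f j).
have LD u v : L (u + v) = L u + L v.
  by rewrite -big_split /=; apply: eq_bigr => j _; rewrite mxE scalerDl.
have Lx : L x = msg *m G1.
  rewrite mulmx_sum_row /L.
  pose F i := pad n msg 0 i *: pmono (nth set0 s i).
  rewrite (eq_bigr (fun j => F (p j))) => [|j _]; last by rewrite /F x_val p_f.
  transitivity (\sum_i F i); first by rewrite [RHS](reindex_perm p).
  have le_P := big_ord_widen n
    (fun i => (if insub i is Some j then msg 0 (j : 'I_k) else 0) *: pmono (nth set0 s i)) le_kn.
  transitivity (\sum_(i < k) (if insub (i : nat) is Some j then msg 0 (j : 'I_k) else 0)
      *: pmono (nth set0 s i)); last first.
    apply: eq_bigr => i _; rewrite row_G1 nth_s //; congr (_ *: _).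
    by rewrite valK.
  rewrite le_P [RHS]big_mkcond; apply: eq_bigr => i _; rewrite /F mxE.
  by case: ifPn => // ge_k; rewrite insubN // scale0r.
pose V := pRM_mod1 r m; pose B := [set u : 'rV['F_2]_n | supp_in H u].
have L_V u : u \in B -> L u \in V.
  rewrite inE => /supp_inP su; apply: rpred_sum => j _.
  have [Hj|nHj] := boolP (H j); last by rewrite su // scale0r rpred0.
  apply/rpredZ/memv_span; rewrite pmonomialsE; apply: map_f.
  by rewrite mem_enum inE.
have V_L v : v \in V -> exists2 u, u \in B & L u = v.
  rewrite /V /pRM_mod1 pmonomialsE.
  case/(supp_in_span (P := H) (F := fun j => pmono (f j))) => [w|u su Lu].
    case/mapP=> A; rewrite mem_enum inE => /andP[A_gt0 A_le] ->.
    have [|j eq_A] := f_surj A; first exact: leq_trans le_rd.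
    by exists j; rewrite /= ?eq_A // A_gt0.
  by exists u; rewrite // inE.
(* The perturbation given by [act_c] varies with [u], so [h] is not computed. It is injective from
   [B] to [V], and [L] maps [B] onto [V], so [h] is a bijection; the same count gives the size of
   [V] and thus the normalizing factor. *)
pose h u := circuit_act c (x + u) - msg *m G1.
have h_inj : injective h by move=> u v /addIr/(circuit_act_inj wf_c)/addrI.
have h_V u : u \in B -> h u \in V.
  move=> B_u; have [j hi_j|u' su' eq_u'] := act_c (x + u).
    rewrite mxE x_low // add0r; move: B_u; rewrite inE => /supp_inP; apply => /=.
    by rewrite negb_and -[X in _ || X]ltnNge (leq_ltn_trans le_rd hi_j) orbT.
  rewrite /h eq_u' -/(L _) -addrA LD Lx [_ + L _]addrC addrK; apply: L_V.
  by move: B_u; rewrite !inE => B_u; apply: supp_inD.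
have le_VB : (#|[set v in V]| <= #|B|)%N.
  apply: leq_trans (leq_imset_card L _); apply: subset_leq_card.
  apply/subsetP=> v; rewrite inE => /V_L[u B_u <-]; exact: imset_f.
have hB : h @: B = [set v in V].
  apply/eqP; rewrite eqEcard card_imset // le_VB andbT.
  by apply/subsetP=> _ /imsetP[u B_u ->]; rewrite inE h_V.
have cardV : #|[pred v in V]| = (2 ^ size hs)%N.
  by rewrite -cardE -card_supp_in -/B -(card_imset B h_inj) hB cardsE.
have supp_hs u : supp_in (mem hs) u = (u \in B).
  by rewrite inE; apply: eq_forallb => j; rewrite /= mem_enum.
rewrite /= -!mulmxA Relabel_ket -/x.
have := Hadamard_layer_ket C (enum_uniq H) x_H; rewrite -/hs => ->.
rewrite -scalemxAr mulmx_sumr /codeword cardV natrX rootCX ?ler0n //.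
congr (_ *: _); rewrite [RHS](eq_bigl (fun v => v \in [set v in V])); last first.
  by move=> v; rewrite [RHS]in_set.
rewrite -hB big_imset /=; last by move=> u v _ _; apply: h_inj.
apply: eq_big => u; first exact: supp_hs.
by move=> _; rewrite circuit_act_ket // /h addrCA subrr addr0.
Qed.

End Encoder.

Theorem mainTheorem8 :
  exists K : nat,
  forall (R : realType) (rd md i r m : nat),
    (rd < md)%N ->
    (i <= minn rd (md - rd - 1))%N ->
    r = (rd - i)%N ->
    m = (md - i)%N ->
    exists (U : 'M[R[i]]_(qdim (2 ^ m).-1)) (c : circuit (2 ^ m).-1),
      [/\ U \is unitarymx,
          is_encoder r rd U,
          circuit_wf c /\ U = circuit_mx R[i] c,
          (depth c <= K * m)%N &
          CNOT_count c = zeta_star_0 rd md r%:Z m].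
Proof.
(* The layers are one of Hadamard gates, [k0 + 1] pruned, [2 * rd + 1] chain and [rd] block layers:
   [k0 + 3 * rd + 3] in all, at most [3 * m]. *)
exists 3%N => R rd md i r m lt_rd le_i eq_r eq_m.
have [k0 eq_k0] : exists k0, m = (k0 + rd).+1.
  by exists (m - rd.+1)%N; move: le_i; rewrite leq_min; lia.
have eq_md : (md + r = rd + k0.+1 + rd)%N by lia.
have le_r : (r <= rd)%N by rewrite eq_r leq_subr.
have := zeta_star_0E eq_md; rewrite [(rd + k0)%N]addnC -eq_k0 => zetaE.
clear eq_m eq_r; subst m.
have [c [enc_c wf_c depth_c count_c]] := encoder_exists R[i] k0 le_r.
exists (circuit_mx R[i] c), c; split=> //.
- exact: circuit_mx_unitary.
- by rewrite depth_c; lia.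
by move: count_c; rewrite -zetaE => /addIn/addIn.
Qed.
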